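(* Let $r\geq 2$ and $t\geq 1$ be integers and let $\mathcal{H}_1,\ldots,\mathcal{H}_t$ be finite hypergraphs. Then $$\chi\big(\operatorname{KG}^r(\mathcal{H}_1)\times\cdots\times\operatorname{KG}^r(\mathcal{H}_t)\big)\geq\left\lceil\frac{1}{r-1}\min_{i\in[t]}\operatorname{ecd}^{r}(\mathcal{H}_i)\right\rceil.$$
   Context: A hypergraph $\mathcal{H}$ consists of a finite vertex set $V(\mathcal{H})$ and a family $E(\mathcal{H})$ of nonempty subsets of $V(\mathcal{H})$ (hyperedges). A proper coloring is a coloring of the vertices with no monochromatic hyperedge; $\chi$ denotes the minimum number of colors in a proper coloring. For $r\geq 2$, the general Kneser hypergraph $\operatorname{KG}^r(\mathcal{H})$ is the $r$-uniform hypergraph with vertex set $E(\mathcal{H})$ whose hyperedges are the $r$-sets of pairwise disjoint hyperedges of $\mathcal{H}$. The categorical product $\mathcal{G}_1\times\cdots\times\mathcal{G}_t$ has vertex set $V(\mathcal{G}_1)\times\cdots\times V(\mathcal{G}_t)$, and a set $e$ of vertices is a hyperedge iff for every $i$ its projection onto the $i$-th coordinate is a hyperedge of $\mathcal{G}_i$. An equitable $r$-coloring is a proper coloring with $r$ colors whose color class sizes pairwise differ by at most $1$; $\operatorname{ecd}^r(\mathcal{H})$ is the minimum number of vertices whose removal leaves an induced subhypergraph admitting an equitable $r$-coloring. *)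

(* Defs.v *)
From HB Require Import structures.
From mathcomp Require Import all_boot all_order all_algebra.

Set Implicit Arguments.
Unset Strict Implicit.
Unset Printing Implicit Defensive.

Record hypergraph := Hypergraph {
  vert : finType;
  edges : {set {set vert}};
  edges_neq0 : set0 \notin edges
}.

Definition monochromatic (G : hypergraph) (k : nat)
    (c : {ffun vert G -> 'I_k}) (e : {set vert G}) : bool :=
  [exists a : 'I_k, forall v in e, c v == a].

Definition proper_coloring (G : hypergraph) (k : nat)
    (c : {ffun vert G -> 'I_k}) : bool :=
  [forall e in edges G, ~~ monochromatic c e].

Definition colorable (G : hypergraph) (k : nat) : bool :=
  [exists c : {ffun vert G -> 'I_k}, proper_coloring c].

(* If every hyperedge has at least two vertices, then #|vert G| colors are     *)
(* enough and chi G is the least k such that G is k-colorable (chi_colorable,  *)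
(* chi_min). A hypergraph with a singleton hyperedge has no proper coloring,   *)
(* and its chi has no meaning.                                                 *)
Definition chi (G : hypergraph) : nat :=
  [arg min_(k < ord_max : 'I_(#|vert G|.+1) | colorable G k) (k : nat)].

Definition equitable_coloring (G : hypergraph) (r : nat)
    (c : {ffun vert G -> 'I_r}) : bool :=
  proper_coloring c &&
  [forall a : 'I_r, forall b : 'I_r,
     #|[set v | c v == a]| <= #|[set v | c v == b]| + 1].

Definition equitably_colorable (G : hypergraph) (r : nat) : bool :=
  [exists c : {ffun vert G -> 'I_r}, equitable_coloring c].

Section Induced.
Variables (G : hypergraph) (S : {set vert G}).

Definition induced_edges : {set {set {v : vert G | v \in S}}} :=
  [set e : {set {v : vert G | v \in S}} | [set val v | v in e] \in edges G].

Lemma induced_edges_neq0 : set0 \notin induced_edges.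
Proof. by rewrite inE imset0 edges_neq0. Qed.

Definition induced : hypergraph := Hypergraph induced_edges_neq0.
End Induced.

(* The default U := setT is always admissible (equitably_colorable_setT).      *)
Definition ecd (r : nat) (G : hypergraph) : nat :=
  #|[arg min_(U < [set: vert G] | equitably_colorable (induced (~: U)) r) #|U|]|.

Section Kneser.
Variables (r : nat) (r_gt1 : 1 < r) (G : hypergraph).

Definition KG_edges : {set {set {e : {set vert G} | e \in edges G}}} :=
  [set A : {set {e : {set vert G} | e \in edges G}} |
     (#|A| == r) && trivIset [set val e | e in A]].

Lemma KG_edges_neq0 : set0 \notin KG_edges.
Proof. by rewrite inE cards0; case: r r_gt1. Qed.

Definition KG : hypergraph := Hypergraph KG_edges_neq0.
End Kneser.

Section CategoricalProduct.
Variables (t : nat) (t_gt0 : 0 < t) (G : 'I_t -> hypergraph).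

Definition catprod_edges :
    {set {set {dffun forall i : 'I_t, vert (G i)}}} :=
  [set e : {set {dffun forall i : 'I_t, vert (G i)}} |
     [forall i : 'I_t,
        [set x i | x : {dffun forall i : 'I_t, vert (G i)} in e]
          \in edges (G i)]].

Lemma catprod_edges_neq0 : set0 \notin catprod_edges.
Proof.
rewrite inE negb_forall; apply/existsP; exists (Ordinal t_gt0).
by rewrite imset0 edges_neq0.
Qed.

Definition catprod : hypergraph := Hypergraph catprod_edges_neq0.
End CategoricalProduct.

Definition min_fam (t : nat) (t_gt0 : 0 < t) (f : 'I_t -> nat) : nat :=
  \big[minn/f (Ordinal t_gt0)]_(i < t) f i.

Lemma colorable_card (G : hypergraph) :
  (forall e, e \in edges G -> 1 < #|e|) -> colorable G #|vert G|.
Proof.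
move=> big_e; apply/existsP; exists [ffun v => enum_rank v].
apply/forallP => e; apply/implyP => eG; apply/negP => /existsP[a /forallP ea].
have /card_gt1P[x [y [xe ye /negP]]] := big_e e eG; apply.
move: (ea x) (ea y); rewrite xe ye !ffunE /= => /eqP xa /eqP ya.
by apply/eqP/enum_rank_inj; rewrite xa ya.
Qed.

Lemma chi_colorable (G : hypergraph) :
  (forall e, e \in edges G -> 1 < #|e|) -> colorable G (chi G).
Proof.
by move=> big_e; rewrite /chi; case: arg_minnP => //=; exact: colorable_card.
Qed.

Lemma chi_min (G : hypergraph) (k : nat) :
  (forall e, e \in edges G -> 1 < #|e|) -> colorable G k -> chi G <= k.
Proof.
move=> big_e Gk; rewrite /chi; case: arg_minnP => [|i _ le_i] /=.
  exact: colorable_card.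
have [lt_k|] := ltnP k #|vert G|.+1; first exact: (le_i (Ordinal lt_k)).
by move/ltnW; apply: leq_trans; rewrite -ltnS.
Qed.

Lemma catprod_KG_edges_gt1 (r t : nat) (r_gt1 : 1 < r) (t_gt0 : 0 < t)
    (H : 'I_t -> hypergraph) (e : {set vert (catprod t_gt0 (fun i => KG r_gt1 (H i)))}) :
  e \in edges (catprod t_gt0 (fun i => KG r_gt1 (H i))) -> 1 < #|e|.
Proof.
rewrite inE => /forallP/(_ (Ordinal t_gt0)); rewrite inE => /andP[/eqP er _].
by apply: (leq_trans r_gt1); rewrite -[X in X <= _]er leq_imset_card.
Qed.

Lemma equitably_colorable_setT (G : hypergraph) (r : nat) :
  equitably_colorable (induced (~: [set: vert G])) r.
Proof.
have noV (v : vert (induced (~: [set: vert G]))) : False.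
  by have := valP v; rewrite !inE.
apply/existsP; exists [ffun v => False_rect _ (noV v)].
apply/andP; split.
  apply/forallP => e; apply/implyP => eG.
  have [e0|[v]] := set_0Vmem e; last by case: (noV v).
  by move: eG; rewrite e0 (negPf (edges_neq0 _)).
apply/forallP => a; apply/forallP => b.
rewrite (_ : [set v | _ v == a] = set0) ?cards0 //.
by apply/setP => v; case: (noV v).
Qed.

Lemma ecd_attained (r : nat) (G : hypergraph) :
  exists2 U : {set vert G},
    #|U| = ecd r G & equitably_colorable (induced (~: U)) r.
Proof.
rewrite /ecd; case: arg_minnP => [|U HU _]; last by exists U.
exact: equitably_colorable_setT.
Qed.

Lemma ecd_min (r : nat) (G : hypergraph) (U : {set vert G}) :
  equitably_colorable (induced (~: U)) r -> ecd r G <= #|U|.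
Proof.
move=> HU; rewrite /ecd; case: arg_minnP => [|W _]; last exact.
exact: equitably_colorable_setT.
Qed.

Lemma min_fam_attained (t : nat) (t_gt0 : 0 < t) (f : 'I_t -> nat) :
  exists i, min_fam t_gt0 f = f i.
Proof.
rewrite /min_fam.
elim/big_ind: _ => [|x y [i ->] [j ->]|i _]; [by eexists| |by exists i].
by rewrite /minn; case: ifP => _; [exists i|exists j].
Qed.

Lemma min_fam_le (t : nat) (t_gt0 : 0 < t) (f : 'I_t -> nat) (i : 'I_t) :
  min_fam t_gt0 f <= f i.
Proof.
rewrite /min_fam; have: i \in index_enum 'I_t by rewrite mem_index_enum.
elim: index_enum => [//|j s IHs]; rewrite inE big_cons geq_min.
by case/orP=> [/eqP ->|/IHs ->]; rewrite ?leqnn ?orbT.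
Qed.

(* Main.v *)
Require Import Defs.
From HB Require Import structures.
From mathcomp Require Import all_boot all_order all_algebra.

Set Implicit Arguments.
Unset Strict Implicit.
Unset Printing Implicit Defensive.

Import Order.TTheory GRing.Theory Num.Theory.
Local Open Scope ring_scope.

(* Let [C] colors be given with [(r - 1) C < ecd^r (H_i)] for all [i]; we look for [r]
   tuples of one color which are disjoint in every coordinate.  This is a bit more than a
   monochromatic hyperedge of the product, and it is what makes Kriz's induction
   go through: the property passes from [r1] and [r2] to [r1 r2] by applying it for [r2] to
   the hypergraphs whose edges are the sets [A] with [ecd^r1 (H_i[A]) > (r1 - 1) C].

   For [r = p] prime, suppose there are no such tuples.  To a nonzero vector [X] of signs
   in [Z/p + {0}], indexed by the disjoint union of the vertex sets ([n] vertices in all),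
   attach subsets of [Z/p] which depend equivariantly on [X]: the signs whose parts contain
   an edge of [H_i], the signs whose parts in [H_i] are smallest, and, for each color, the
   signs whose parts contain a tuple of that color (never all signs).  A nonempty proper
   subset [B] of [Z/p] has an equivariant sign, its barycenter.  Suitable cardinals make up
   a level in [1, n - 1] that is monotone in [X], and comparable vectors on one level have
   the same sign.

   This is impossible: chains whose boundaries alternate between [(g - 1) c] and
   [(\sum_g g) c] exist up to dimension [n - 1] in the n-fold join of [Z/p], and an explicit
   cochain on sequences of signs, zero on sequences with two equal neighbours, takes the
   value [1] on the image of the top one.  So some maximal chain of vectors changes sign at
   every step, and its [n] levels are distinct. *)

(** * Cochains on sequences *)

Section Coboundary.
Variables (R : zmodType).

(** Recursive form of the alternating sum over all deletions of one entry. The empty sequence counts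
    as a face, so this is the augmented coboundary. *)
Fixpoint cobd (A : Type) (f : seq A -> R) (s : seq A) : R :=
  if s is x :: s' then f s' - cobd (fun u => f (x :: u)) s' else 0.

Lemma eq_cobd (A : eqType) (f g : seq A -> R) s :
  (forall u, subseq u s -> (size u).+1 = size s -> f u = g u) ->
  cobd f s = cobd g s.
Proof.
elim: s f g => [//|x s IH] f g fg /=; congr (_ - _).
  by apply: fg; rewrite ?subseq_cons.
by apply: IH => u us su; apply: fg; rewrite /= ?eqxx // su.
Qed.

Lemma cobd0 (A : Type) s : cobd (fun _ : seq A => 0) s = 0.
Proof. by elim: s => //= x s ->; rewrite subr0. Qed.

Lemma cobdB (A : eqType) (f g : seq A -> R) s :
  cobd (fun u => f u - g u) s = cobd f s - cobd g s.
Proof.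
elim: s f g => [|x s IH] f g /=; first by rewrite subr0.
by rewrite IH !opprD addrACA.
Qed.

Lemma cobd_sum (A : eqType) (I : finType) (F : I -> seq A -> R) s :
  cobd (fun u => \sum_i F i u) s = \sum_i cobd (F i) s.
Proof.
elim: s F => [|x s IH] F /=; first by rewrite big1.
by rewrite IH sumrB.
Qed.

Lemma cobd_cobd (A : eqType) (f : seq A -> R) s : cobd (cobd f) s = 0.
Proof.
elim: s f => [//|x s IH] f /=.
by rewrite cobdB IH subr0 subrr.
Qed.

Lemma cobd_map (A B : eqType) (h : A -> B) (f : seq B -> R) s :
  cobd f (map h s) = cobd (fun u => f (map h u)) s.
Proof. by elim: s f => [//|x s IH] f /=; rewrite IH. Qed.

(** Deleting either of two equal neighbours gives the same sequence with opposite signs; every other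
    deletion keeps the equal pair. *)
Lemma cobd_degenerate (A : eqType) (f : seq A -> R) :
  (forall s, ~~ sorted [rel x y | x != y] s -> f s = 0) ->
  forall s, ~~ sorted [rel x y | x != y] s -> cobd f s = 0.
Proof.
move=> f0 s; elim: s f f0 => [//|x [//|y s] IH] f f0.
rewrite [sorted _ _]/= negb_and negbK => deg.
have [/eqP yx|ys] := boolP (x == y).
  rewrite /= yx opprB addrCA subrr addr0.
  rewrite -[RHS](cobd0 s); apply: eq_cobd => u _ _.
  by apply: f0; rewrite /= eqxx.
have {deg ys}ys : ~~ path [rel x y | x != y] y s by move: deg; rewrite (negPf ys).
have -> : cobd f [:: x, y & s] = f (y :: s) - cobd (fun u => f (x :: u)) (y :: s) by [].
rewrite f0 // IH ?subr0 // => u du; apply: f0; apply: contra du.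
exact: path_sorted.
Qed.

End Coboundary.

Section Subdivision.
Variables (R : zmodType) (A B : eqType) (b : seq A -> B).

(* Dual of barycentric subdivision: a simplex s is subdivided into the cones
   with apex b s over the subdivided facets of s. *)
Fixpoint sdiv k (f : seq B -> R) (s : seq A) : R :=
  if k is k'.+1 then cobd (sdiv k' (fun u => f (b s :: u))) s else f [::].

Lemma sdivB k f g s :
  sdiv k (fun u => f u - g u) s = sdiv k f s - sdiv k g s.
Proof.
elim: k f g s => [//|k IH] f g s /=; rewrite -cobdB.
by apply: eq_cobd => u _ _; rewrite IH.
Qed.

Lemma sdiv0 k s : sdiv k (fun=> 0) s = 0.
Proof. by elim: k s => //= k IH s; rewrite -[RHS](cobd0 _ s); apply: eq_cobd. Qed.

Lemma sdiv_sum (I : finType) k (F : I -> seq B -> R) s :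
  sdiv k (fun u => \sum_i F i u) s = \sum_i sdiv k (F i) s.
Proof.
elim: k F s => [//|k IH] F s /=; rewrite -cobd_sum.
by apply: eq_cobd => u _ _; rewrite IH.
Qed.

(** Dual of the fact that subdivision is a chain map: the boundary of a cone is its base minus the
    cone over the boundary of the base, and by induction the second part contributes a double
    coboundary. *)
Lemma cobd_sdiv k f s :
  size s = k.+1 -> cobd (sdiv k f) s = sdiv k.+1 (cobd f) s.
Proof.
elim: k f s => [|k IH] f s sk.
  by case: s sk => [|x []] //= _; rewrite !subr0.
have -> : sdiv k.+2 (cobd f) s =
    cobd (fun v => sdiv k.+1 f v - sdiv k.+1 (cobd (fun u => f (b s :: u))) v) s.
  by apply: eq_cobd => v _ _; rewrite -sdivB.
rewrite cobdB [X in _ - X](_ : _ = 0) ?subr0 //.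
rewrite -[RHS](cobd_cobd (sdiv k (fun u => f (b s :: u))) s).
by apply: eq_cobd => v _; rewrite sk => -[vk]; rewrite IH.
Qed.


End Subdivision.

(** * The periodic resolution of [Z/p], acting on cochains *)

Section Twist.
Variables (p : nat) (A : eqType) (act : 'F_p -> A -> A).
Hypothesis act0 : forall x, act 0 x = x.
Hypothesis actD : forall g h x, act g (act h x) = act (g + h) x.
Implicit Type f : seq A -> 'F_p.

(* The elements g - 1 (k odd) and \sum_g g (k even) of the group ring, whose
   products in either order vanish. *)
Definition twist k f (s : seq A) : 'F_p :=
  if k == 0%N then f s
  else if odd k then f (map (act 1) s) - f s
  else \sum_g f (map (act g) s).

Lemma eq_twist k f f' s :
  (forall g, f (map (act g) s) = f' (map (act g) s)) -> twist k f s = twist k f' s.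
Proof.
move=> ff'; have e0 : f s = f' s.
  by have := ff' 0; rewrite (eq_map act0) map_id.
rewrite /twist; case: ifP => // _; case: ifP => _; first by rewrite ff' e0.
by apply: eq_bigr.
Qed.

Lemma twistB k f f' s :
  twist k (fun u => f u - f' u) s = twist k f s - twist k f' s.
Proof.
rewrite /twist; case: ifP => // _; case: ifP => _; last by rewrite sumrB.
by rewrite !opprD addrACA.
Qed.

Lemma twist_cobd k f s : twist k (cobd f) s = cobd (twist k f) s.
Proof.
rewrite /twist; case: ifP => // _; case: ifP => _.
  by rewrite cobd_map -cobdB.
by rewrite cobd_sum; apply: eq_bigr => g _; rewrite cobd_map.
Qed.

Lemma twist_twist k f s : twist k.+1 (twist k.+2 f) s = 0.
Proof.
have mapD g h u : map (act g) (map (act h) u) = map (act (g + h)) u.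
  by rewrite -map_comp; apply: eq_map => x; exact: actD.
rewrite /twist /= negbK; case: (odd k) => /=.
  under eq_bigr do rewrite mapD.
  apply/eqP; rewrite sumrB subr_eq0; apply/eqP.
  by rewrite [RHS](reindex_inj (addrI 1)).
apply/eqP; rewrite subr_eq0; apply/eqP.
under eq_bigr do rewrite mapD.
by rewrite [RHS](reindex_inj (addIr 1)).
Qed.

Lemma twist0 k f s : (forall g, f (map (act g) s) = 0) -> twist k f s = 0.
Proof.
move=> f0; rewrite (@eq_twist _ _ (fun=> 0)) // /twist subrr big1 //.
by rewrite !if_same.
Qed.

Lemma twist_nil f : twist 1 f [::] = 0.
Proof. by rewrite /twist /= subrr. Qed.

End Twist.

(** * An explicit cochain on sequences of signs *)

Section SignCochain.
Variable p : nat.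
Local Notation tw := (twist (fun g x : 'F_p => x + g)).

(** Built so that the twist of each cochain is the coboundary of the previous one. In odd degree a
    cochain of norm zero is written as a difference of partial sums over translates; in even degree
    an invariant cochain is the norm of its restriction to sequences starting with 0. *)
Fixpoint sign_cochain k (s : seq 'F_p) : 'F_p :=
  match k, s with
  | 0, _ => (s == [::])%:R
  | k'.+1, [::] => 0
  | k'.+1, x :: _ =>
      if odd k then \sum_(i < x) cobd (sign_cochain k') [seq y - x + i%:R | y <- s]
      else (x == 0)%:R * cobd (sign_cochain k') s
  end.

Lemma sign_cochain_degenerate k s :
  ~~ sorted [rel x y | x != y] s -> sign_cochain k s = 0.
Proof.
elim: k s => [|k IH] [|x s] //= ds.
case: ifP => _; last first.
  have -> : sign_cochain k s - cobd (fun u => sign_cochain k (x :: u)) s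
     = cobd (sign_cochain k) (x :: s) by [].
  by rewrite cobd_degenerate ?mulr0.
rewrite big1 // => i _.
have := @cobd_degenerate _ _ (sign_cochain k) IH [seq y - x + i%:R | y <- x :: s].
apply; apply: contra ds; rewrite sorted_map; apply: sub_path => a b /=.
by apply: contra => /eqP ->.
Qed.

Lemma sum_Fp_char (a : 'F_p) : \sum_(g : 'F_p) a = 0.
Proof.
rewrite sumr_const card_ord -mulr_natr.
suff -> : ((Zp_trunc (pdiv p)).+2%:R : 'F_p) = 0 by rewrite mulr0.
by rewrite Zp_nat; apply: val_inj; rewrite /= modnn.
Qed.

(** The sums telescope, unless [x] is the last residue: then [x + 1] wraps around to 0, the first
    sum is empty, and the vanishing norm makes minus the second sum equal to its missing last
    term. *)
Lemma diff_partial_sum (psi : seq 'F_p -> 'F_p) (x : 'F_p) (s : seq 'F_p) :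
  (forall u, \sum_g psi [seq y + g | y <- u] = 0) ->
  (\sum_(i < (x + 1 : 'F_p)%R) psi [seq y - (x + 1) + i%:R | y <- [seq y + 1 | y <- x :: s]])
  - \sum_(i < x) psi [seq y - x + i%:R | y <- x :: s] = psi (x :: s).
Proof.
move=> psi0; pose rho (i : nat) := psi [seq y - x + i%:R | y <- x :: s].
have rhoE (i : nat) :
    psi [seq y - (x + 1) + i%:R | y <- [seq y + 1 | y <- x :: s]] = rho i.
  rewrite -map_comp; congr psi; apply: eq_map => y /=; congr (_ + _).
  by rewrite opprD addrACA subrr addr0.
under eq_bigr do rewrite rhoE.
rewrite -[X in _ - X]/(\sum_(i < x) rho i).
have rhox : rho x = psi (x :: s).
  by rewrite /rho natr_Zp (eq_map (subrK x)) map_id.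
have [xp|xp] := ltnP x.+1 (Zp_trunc (pdiv p)).+2.
  have -> : nat_of_ord (x + 1)%R = x.+1.
    by rewrite /= (modn_small (isT : (1 < _.+2)%N)) addn1 modn_small.
  by rewrite big_ord_recr /= addrAC subrr add0r.
have xE : x.+1 = (Zp_trunc (pdiv p)).+2.
  by apply/eqP; rewrite eqn_leq xp andbT; exact: ltn_ord.
have -> : nat_of_ord (x + 1)%R = 0%N.
  by rewrite /= (modn_small (isT : (1 < _.+2)%N)) addn1 xE modnn.
rewrite big_ord0 sub0r; apply/eqP; rewrite eq_sym -subr_eq0 opprK addrC -rhox; apply/eqP.
have := psi0 [seq y - x | y <- x :: s].
have -> : \sum_(g : 'F_p) psi [seq y + g | y <- [seq y - x | y <- x :: s]]
  = \sum_(i < (Zp_trunc (pdiv p)).+2) rho i.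
  apply: eq_bigr => g _; rewrite -map_comp; congr psi.
  by apply: eq_map => y /=; rewrite natr_Zp.
suff sumE n : n = x.+1 -> \sum_(i < n) rho i = \sum_(i < x) rho i + rho x.
  by rewrite (sumE _ (esym xE)).
by move=> ->; rewrite big_ord_recr.
Qed.

Lemma twist_cobd_sign_cochain k s :
  (forall u, tw k.+1 (sign_cochain k.+1) u = cobd (sign_cochain k) u) ->
  tw k.+1 (cobd (sign_cochain k.+1)) s = 0.
Proof.
move=> IH; rewrite twist_cobd -[RHS](cobd_cobd (sign_cochain k) s).
by apply: eq_cobd => u _ _; rewrite IH.
Qed.

(** This coboundary is invariant under translation, so its norm adds up one value over all of
    ['F_p]. *)
Lemma norm_cobd_sign_cochain0 s :
  \sum_g cobd (sign_cochain 0) [seq y + g | y <- s] = 0.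
Proof.
rewrite -[RHS](sum_Fp_char (cobd (sign_cochain 0) s)).
apply: eq_bigr => g _; rewrite cobd_map.
by apply: eq_cobd => u _ _ /=; case: u.
Qed.

Lemma twist_sign_cochain k s :
  tw k.+1 (sign_cochain k.+1) s = cobd (sign_cochain k) s.
Proof.
elim: k s => [|k IH] [|x s].
- by rewrite /twist /= subrr.
- by rewrite /twist [odd _]/=; apply: diff_partial_sum norm_cobd_sign_cochain0.
- rewrite /twist [LHS]/= negbK; case: ifP => _; first by rewrite subrr.
  by rewrite big1.
have := fun u => twist_cobd_sign_cochain u IH.
have phiE y u : sign_cochain k.+2 (y :: u) =
    if odd k.+2 then \sum_(i < y) cobd (sign_cochain k.+1) [seq z - y + i%:R | z <- y :: u]
      else (y == 0)%:R * cobd (sign_cochain k.+1) (y :: u) by [].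
move: phiE; move: (sign_cochain k.+2) (cobd (sign_cochain k.+1)) => phi psi phiE.
rewrite /twist /= negbK; have [ko|ko] /= := boolP (odd k) => psi0.
  by rewrite !phiE /= ko; apply: diff_partial_sum.
(* Here [psi0] says that [psi] is invariant under translation by 1; iteration gives all
   translations. *)
have inv g u : psi [seq y + g | y <- u] = psi u.
  rewrite -(natr_Zp g); elim: (nat_of_ord g) => [|i IHi].
    by rewrite (eq_map (fun y : 'F_p => addr0 y)) map_id.
  rewrite -[RHS]IHi; apply/eqP; rewrite -subr_eq0; apply/eqP.
  rewrite -[RHS](psi0 [seq y + i%:R | y <- u]) -map_comp; congr (psi _ - _).
  by apply: eq_map => y /=; rewrite -natr1 addrA.
under eq_bigr => g _ do
  rewrite phiE /= (negPf ko) -[X in _ * X]/(psi [seq y + g | y <- x :: s]) inv.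
(* Only the translate by [- x] starts with 0. *)
rewrite -mulr_suml (bigD1 (- x)) //= subrr eqxx big1 ?addr0 ?mul1r // => g.
by rewrite -subr_eq0 opprK addrC => /negPf ->.
Qed.

End SignCochain.

(** * A Tucker lemma for cyclic groups *)

Section ZpTucker.
Variables (p : nat) (W : finType) (ws : seq W).
Local Notation cell := (W * 'F_p)%type.
Implicit Types (s u : seq cell) (X Y : {set cell}).

Definition act_cell (g : 'F_p) (x : cell) : cell := (x.1, x.2 + g).

Definition shift_set (g : 'F_p) X : {set cell} := [set act_cell g x | x in X].

(** A nonzero vector of signs, encoded by its graph; equivalently a nonempty simplex of the join of
    copies of [Z/p]. *)
Definition signed_set X : bool :=
  [&& X != set0, [forall x in X, x.1 \in ws]
    & [forall x in X, forall y in X, (x.1 == y.1) ==> (x == y)]].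

Lemma act_cell0 x : act_cell 0 x = x.
Proof. by case: x => w g; rewrite /act_cell addr0. Qed.

Lemma act_cellD g h x : act_cell g (act_cell h x) = act_cell (g + h) x.
Proof. by rewrite /act_cell /= -addrA [h + g]addrC. Qed.

Lemma mem_shift_set g X w h : ((w, h) \in shift_set g X) = ((w, h - g) \in X).
Proof.
apply/imsetP/idP => [[[w' h'] wX [-> ->]]|wX]; first by rewrite addrK.
by exists (w, h - g) => //; rewrite /act_cell subrK.
Qed.

Local Notation tw := (twist act_cell).
Local Notation bary := (fun s : seq cell => [set x in s]).

Definition signed_seq s := uniq (map fst s) && all (fun x => x.1 \in ws) s.

Lemma signed_seq_sub s u : subseq u s -> signed_seq s -> signed_seq u.
Proof.
move=> us /andP[Us /allP As]; apply/andP; split.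
  by apply: subseq_uniq Us; exact: map_subseq.
by apply/allP => x xu; apply: As; exact: (mem_subseq us).
Qed.

Lemma signed_seq_set s : signed_seq s -> s != [::] -> signed_set [set x in s].
Proof.
move=> /andP[Us /allP As] s0; apply/and3P; split.
- by apply/set0Pn; case: s s0 {Us As} => // x s _; exists x; rewrite inE mem_head.
- by apply/forallP => x; apply/implyP; rewrite inE; exact: As.
apply/forallP => x; apply/implyP; rewrite inE => xs.
apply/forallP => y; apply/implyP; rewrite inE => ys; apply/implyP => /eqP exy.
rewrite -(nth_index x xs) -(nth_index x ys) in exy *.
move/uniqP: Us => /(_ x.1) inj; rewrite -!(nth_map x x.1 fst) ?index_mem // in exy.
by rewrite (inj _ _ _ _ exy) // inE size_map index_mem.
Qed.

Definition descending (X : {set cell}) (Xs : seq {set cell}) : bool :=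
  path (fun X Y : {set cell} => Y \subset X) X Xs.

(** Each apex of the subdivision is the set of entries of a subsequence of [s], so only descending
    flags of signed sets are met. *)
Lemma eq_sdiv (R : zmodType) k (f g : seq {set cell} -> R) s :
  signed_seq s -> size s = k ->
  (forall Xs, size Xs = k -> all signed_set Xs -> descending [set x in s] Xs ->
     f Xs = g Xs) ->
  sdiv bary k f s = sdiv bary k g s.
Proof.
elim: k f g s => [|k IH] f g s ss sk fg /=; first exact: fg.
apply: eq_cobd => u us; rewrite sk => -[uk].
apply: IH => // [|Xs Xk Xgood Xdesc]; first exact: signed_seq_sub ss.
apply: fg => /=; rewrite ?Xk ?Xgood ?andbT //.
  by apply: signed_seq_set; rewrite // -size_eq0 sk.
rewrite /descending /= subxx /=.
case: Xs Xdesc {Xk Xgood} => //= Y Xs /andP[Yu dY]; apply/andP; split; last exact: dY.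
by apply: subset_trans Yu _; apply/subsetP => x; rewrite !inE; exact: mem_subseq.
Qed.

Lemma sdiv_shift (R : zmodType) k (f : seq {set cell} -> R) g s :
  sdiv bary k f (map (act_cell g) s) =
  sdiv bary k (fun Xs => f (map (shift_set g) Xs)) s.
Proof.
elim: k f s => [//|k IH] f s /=; rewrite cobd_map.
apply: eq_cobd => u _ _; rewrite IH.
suff -> : [set x in map (act_cell g) s] = shift_set g [set x in s] by [].
apply/setP => -[w h]; rewrite mem_shift_set !inE.
apply/mapP/idP => [[[w' h'] wX [-> ->]]|wX]; first by rewrite addrK.
by exists (w, h - g) => //; rewrite /act_cell subrK.
Qed.

(* Iterated cones over twisted spheres: a chain whose boundary is the twist of
   the previous one. *)
Fixpoint cone_chain (v : seq W) (f : seq cell -> 'F_p) : 'F_p :=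
  if v is w :: v' then
    cone_chain v' (tw (size v') (fun s => f ((w, 0) :: s)))
  else f [::].

Lemma eq_cone_chain v f g :
  (forall s, map fst s = v -> f s = g s) -> cone_chain v f = cone_chain v g.
Proof.
elim: v f g => [|w v IH] f g fg /=; first exact: fg.
apply: IH => s sv; apply: eq_twist => [x|h]; first exact: act_cell0.
by apply: fg => /=; rewrite -map_comp -sv.
Qed.

Lemma cone_chainB v f g :
  cone_chain v (fun s => f s - g s) = cone_chain v f - cone_chain v g.
Proof.
elim: v f g => [//|w v IH] f g /=; rewrite -IH; apply: eq_cone_chain => s _.
exact: twistB.
Qed.

Lemma cone_chain0 v f : (forall s, map fst s = v -> f s = 0) -> cone_chain v f = 0.
Proof.
move=> f0; rewrite (@eq_cone_chain _ _ (fun s => f s - f s)).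
  by rewrite cone_chainB subrr.
by move=> s sv; rewrite f0 // subrr.
Qed.

(** The base of the cone is the twist of the previous chain, so the cone over its boundary carries
    two consecutive twists and vanishes. *)
Lemma cone_chain_cobd w v f :
  cone_chain (w :: v) (cobd f) = cone_chain v (tw (size v) f).
Proof.
elim: v w f => [|w' v IH] w f; first exact: subr0 (f [::]).
pose h u := f ((w, 0) :: u).
transitivity (cone_chain (w' :: v)
    (fun s => tw (size v).+1 f s - tw (size v).+1 (cobd h) s)).
  apply: (@eq_cone_chain (w' :: v) (tw (size v).+1 (fun s => cobd f ((w, 0) :: s)))).
  by move=> s _; rewrite -twistB.
rewrite cone_chainB [X in _ - X](_ : _ = 0) ?subr0 //.
rewrite (@eq_cone_chain _ _ (cobd (tw (size v).+1 h))) => [|s _]; last exact: twist_cobd.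
(* For empty [v] the outer twist is the identity; there the difference in [twist 1] vanishes at the
   empty sequence. *)
rewrite IH; apply: cone_chain0 => s; case: v {IH} => [|w'' v] sv.
  by case: s sv => // _; exact: twist_nil.
by rewrite twist_twist //; exact: act_cellD.
Qed.

(* Combinatorial form of the non-existence of an equivariant map from the n-fold
   join of Z/p to an (N-1)-dimensional free complex when N < n. *)
Theorem Zp_tucker (sg : {set cell} -> 'F_p) (lev : {set cell} -> nat) (N : nat) :
  uniq ws ->
  (forall X g, signed_set X -> sg (shift_set g X) = sg X + g) ->
  (forall X, signed_set X -> (0 < lev X <= N)%N) ->
  (forall X Y, signed_set X -> signed_set Y -> X \subset Y ->
     (lev X <= lev Y)%N /\ (lev X = lev Y -> sg X = sg Y)) ->
  (size ws <= N)%N.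
Proof.
move=> Uws sgE levN levS; rewrite leqNgt; apply/negP => Nws.
(* The sign cochain is pulled back along [sg] to flags, then along the subdivision to sequences of
   cells. *)
pose F k := sdiv bary k (fun Xs => sign_cochain k (map sg Xs)).
have signed_ws v s : subseq v ws -> map fst s = v -> signed_seq s.
  move=> vws sv; apply/andP; rewrite sv (subseq_uniq vws) //; split=> //.
  by apply/allP => x xs; apply: (mem_subseq vws); rewrite -sv map_f.
(* Equivariance of [sg] turns the twist of [F] into the coboundary of the previous [F]; the boundary
   formula for cones then removes [w]. *)
have step w v : subseq (w :: v) ws -> cone_chain (w :: v) (tw (size v).+1 (F (size v).+1))
    = cone_chain v (tw (size v) (F (size v))).
  move=> wvs; rewrite -[RHS](cone_chain_cobd w); apply: eq_cone_chain => s sv.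
  have ss := signed_ws _ _ wvs sv.
  have sk : size s = (size v).+1 by rewrite -(size_map fst) sv.
  rewrite cobd_sdiv //.
  have FE g : F (size v).+1 (map (act_cell g) s) =
      sdiv bary (size v).+1
        (fun Xs => sign_cochain (size v).+1 [seq y + g | y <- map sg Xs]) s.
    rewrite /F sdiv_shift; apply: eq_sdiv => // Xs _ Xgood _; congr sign_cochain.
    rewrite -!map_comp; apply/eq_in_map => X XX /=.
    by apply: sgE; exact: (allP Xgood).
  transitivity (sdiv bary (size v).+1
    (fun Xs => twist (fun g x => x + g) (size v).+1 (sign_cochain (size v).+1) (map sg Xs)) s).
    rewrite /twist -[_ == 0%N]/false; case: (odd _); first by rewrite sdivB FE.
    by rewrite sdiv_sum; apply: eq_bigr => g _; rewrite FE.
  by apply: eq_sdiv => // Xs _ _ _; rewrite twist_sign_cochain cobd_map.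
have all1 v : subseq v ws -> cone_chain v (tw (size v) (F (size v))) = 1.
  elim: v => [|w v IH] vws; first by rewrite /twist /F /=.
  by rewrite step // IH //; apply: subseq_trans vws; exact: subseq_cons.
(* Levels drop strictly where the sign changes, and the last one is positive. *)
have lev_desc X Xs : all signed_set (X :: Xs) -> descending X Xs ->
    sorted [rel x y | x != y] (map sg (X :: Xs)) -> (size (X :: Xs) <= lev X)%N.
  elim: Xs X => [|Y Xs IH] X /=; first by rewrite andbT => /levN/andP[].
  move=> /andP[gX gYs] /andP[YX dYs] /andP[sXY sYs].
  apply: leq_ltn_trans (IH Y gYs dYs sYs) _.
  have [le_l eq_l] := levS Y X (andP gYs).1 gX YX.
  rewrite ltn_neqAle le_l andbT; apply: contraNneq sXY => /eq_l ->.
  exact: eqxx.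
(* As [N < size ws], no flag of full length alternates in sign, so the value 1 would also be 0. *)
have := all1 ws (subseq_refl _); rewrite cone_chain0 => [/eqP|s sws].
  by rewrite eq_sym oner_eq0.
apply: twist0 => [|g]; first exact: act_cell0.
have ss : signed_seq (map (act_cell g) s).
  by apply: (signed_ws ws) => //; rewrite -map_comp -sws.
have sk : size (map (act_cell g) s) = size ws by rewrite -sws !size_map.
rewrite -[RHS](sdiv0 _ bary (size ws) (map (act_cell g) s)); apply: eq_sdiv => //.
move=> [|X Xs] sX gX dX; first by rewrite -sX in Nws.
apply: sign_cochain_degenerate; apply/negP => altX.
have := lev_desc X Xs gX; rewrite sX => /(_ _ altX).
have /andP[_ lX] := levN X (andP gX).1.
move=> /(_ (andP dX).2)/leq_trans/(_ lX); by rewrite leqNgt Nws.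
Qed.

End ZpTucker.

(** * Balanced families and the reduction to prime r *)

Section BalancedFamilies.
Local Open Scope nat_scope.
Variables (T J : finType).
Implicit Types (E : {set {set T}}) (V : {set T}) (Y Z : {ffun J -> {set T}}).

(** The classes of an equitable coloring of the hypergraph induced on their union. The index type is
    arbitrary, to allow ['F_p] and products. *)
Definition balanced_free E V Y : bool :=
  [&& [forall j, Y j \subset V],
      [forall j, forall k, (j != k) ==> [disjoint Y j & Y k]],
      [forall j, forall e in E, ~~ (e \subset Y j)]
    & [forall j, forall k, #|Y j| <= #|Y k|.+1]].

Lemma balanced_freeP E V Y :
  reflect [/\ forall j, Y j \subset V,
              forall j k, j != k -> [disjoint Y j & Y k],
              forall j e, e \in E -> ~~ (e \subset Y j)
            & forall j k, #|Y j| <= #|Y k|.+1]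
          (balanced_free E V Y).
Proof.
apply: (iffP and4P) => [] [h1 h2 h3 h4]; split.
- exact/forallP.
- by move=> j k; move/forallP/(_ j)/forallP/(_ k)/implyP: h2.
- by move=> j e; move/forallP/(_ j)/forallP/(_ e)/implyP: h3.
- by move=> j k; move/forallP/(_ j)/forallP/(_ k): h4.
- exact/forallP.
- by apply/forallP => j; apply/forallP => k; apply/implyP; exact: h2.
- by apply/forallP => j; apply/forallP => e; apply/implyP; exact: h3.
- by apply/forallP => j; apply/forallP => k; exact: h4.
Qed.

(* In terms of the paper, [ecd > d] for the hypergraph with vertex set [V] whose
   edges are the members of [E] contained in [V]. *)
Definition defect_gt E V (d : nat) : bool :=
  [forall Y : {ffun J -> {set T}}, balanced_free E V Y ==> (\sum_j #|Y j| + d < #|V|)].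

Lemma balanced_free0 E V : set0 \notin E -> balanced_free E V [ffun=> set0].
Proof.
move=> E0; apply/balanced_freeP; split=> [j|j k _|j e eE|j k]; rewrite !ffunE ?cards0 //.
- exact: sub0set.
- by rewrite disjoints_subset sub0set.
by rewrite subset0; apply: contraNneq E0 => <-.
Qed.

Lemma defect_gt_card E V d : set0 \notin E -> defect_gt E V d -> d < #|V|.
Proof.
move=> /balanced_free0 b0 /forallP/(_ [ffun=> set0])/implyP/(_ (b0 V)).
by rewrite big1 // => j _; rewrite ffunE cards0.
Qed.

(** Removing a vertex from a largest class keeps the sizes balanced. *)
Lemma balanced_free_shrink E V Y s :
  balanced_free E V Y -> s <= \sum_j #|Y j| ->
  exists2 Z, balanced_free E V Z & \sum_j #|Z j| = s.
Proof.
move=> bY sY; have [d] : exists d, \sum_j #|Y j| = s + d.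
  by exists (\sum_j #|Y j| - s); rewrite subnKC.
elim: d Y bY {sY} => [|d IH] Y bY Yd; first by exists Y; rewrite // Yd addn0.
have [j0 _ Yj0] : exists2 j, true & 0 < #|Y j|.
  apply/exists_inP; apply: contraPT Yd; rewrite negb_exists_in => /forall_inP Y0.
  rewrite big1 => [|j _]; first by rewrite addnS.
  by apply/eqP; rewrite -leqn0 leqNgt; exact: Y0.
have [h1 h2 h3 h4] := balanced_freeP _ _ _ bY.
pose jm := [arg max_(j > j0) #|Y j|].
have jmax j : #|Y j| <= #|Y jm| by rewrite /jm; case: arg_maxnP => // i _; exact.
have /card_gt0P[x xY] : 0 < #|Y jm| by apply: leq_trans (jmax j0).
pose Z : {ffun J -> {set T}} := [ffun j => if j == jm then Y j :\ x else Y j].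
have ZY j : Z j \subset Y j by rewrite ffunE; case: ifP => // _; exact: subD1set.
have Zjm : #|Y jm| = (#|Z jm|).+1 by rewrite ffunE eqxx (cardsD1 x) xY.
apply: (IH Z).
  apply/balanced_freeP; split.
  - by move=> j; apply: subset_trans (ZY j) (h1 j).
  - move=> j k jk; apply: disjointWl (ZY j) _.
    exact: disjointWr (ZY k) (h2 _ _ jk).
  - by move=> j e eE; apply: contra (h3 j e eE) => /subset_trans; exact.
  move=> j k; have [->|kjm] := eqVneq k jm.
    rewrite -Zjm; apply: leq_trans (jmax j); exact: subset_leq_card.
  rewrite [Z k]ffunE (negPf kjm); apply: leq_trans (h4 j k).
  exact: subset_leq_card.
move: Yd; rewrite (bigD1 jm) //= [in X in _ -> X](bigD1 jm) //= Zjm addSn addnS => -[].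
move=> <-; congr (_ + _); apply: eq_bigr => j jjm.
by rewrite ffunE (negPf jjm).
Qed.

(** Vertices are added one at a time to a smallest class; the edge family [set0] imposes no
    condition. *)
Lemma balanced_partition V (j0 : J) :
  exists2 Y, balanced_free set0 V Y & \sum_j #|Y j| = #|V|.
Proof.
move: {2}#|V| (erefl #|V|) => n; elim: n V => [|n IH] V Vn.
  exists [ffun=> set0]; first by apply: balanced_free0; rewrite inE.
  by rewrite Vn big1 // => j _; rewrite ffunE cards0.
have /card_gt0P[x xV] : 0 < #|V| by rewrite Vn.
have V'n : #|V :\ x| = n by move: Vn; rewrite (cardsD1 x) xV => -[].
have [Y bY Yn] := IH _ V'n; have [h1 h2 _ h4] := balanced_freeP _ _ _ bY.
pose jm := [arg min_(j < j0) #|Y j|].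
have jmin j : #|Y jm| <= #|Y j| by rewrite /jm; case: arg_minnP => // i _; exact.
have xY j : x \notin Y j by apply/negP => /(subsetP (h1 j)); rewrite !inE eqxx.
pose Z : {ffun J -> {set T}} := [ffun j => if j == jm then x |: Y j else Y j].
have YZ j : Y j \subset Z j by rewrite ffunE; case: ifP => // _; exact: subsetUr.
have Zjm : #|Z jm| = (#|Y jm|).+1 by rewrite ffunE eqxx cardsU1 xY.
exists Z.
  apply/balanced_freeP; split.
  - move=> j; have YV := subset_trans (h1 j) (subD1set V x).
    by rewrite ffunE; case: ifP => // _; rewrite subUset sub1set xV.
  - move=> j k jk; rewrite !ffunE; case: eqP => [ej|_]; case: eqP => [ek|_].
    + by rewrite ej ek eqxx in jk.
    + by rewrite disjoints_subset subUset sub1set inE xY -disjoints_subset h2.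
    + rewrite disjoint_sym disjoints_subset subUset sub1set inE xY -disjoints_subset.
      by rewrite h2 // eq_sym.
    + exact: h2.
  - by move=> j e; rewrite inE.
  move=> j k; have [->|jjm] := eqVneq j jm.
    by rewrite Zjm ltnS; apply: leq_trans (jmin k) _; exact: subset_leq_card.
  rewrite [Z j]ffunE (negPf jjm); apply: leq_trans (h4 j k) _.
  by rewrite ltnS subset_leq_card.
rewrite Vn -V'n -Yn (bigD1 jm) //= Zjm [in RHS](bigD1 jm) //= addSn.
by congr (_ + _).+1; apply: eq_bigr => j jjm; rewrite ffunE (negPf jjm).
Qed.

End BalancedFamilies.

(** All data are quantified and [c] is bounded only on tuples of edges, so the property applies to
    derived hypergraphs colored through families chosen inside their edges. *)
Definition monochromatic_family (J : finType) : Prop :=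
  forall (T I : finType) (V : I -> {set T}) (E : I -> {set {set T}})
    (c : {ffun I -> {set T}} -> nat) (C : nat),
  (forall i, set0 \notin E i) ->
  (forall F : {ffun I -> {set T}},
     (forall i, F i \in E i) -> (forall i, F i \subset V i) -> (c F < C)%N) ->
  (forall i, defect_gt J (E i) (V i) ((#|J| - 1) * C)) ->
  exists F : {ffun J -> {ffun I -> {set T}}},
    [/\ forall j i, F j i \in E i, forall j i, F j i \subset V i,
        forall j k i, j != k -> [disjoint F j i & F k i]
      & forall j k, c (F j) = c (F k)].

Lemma monochromatic_family_bij (J K : finType) (h : K -> J) (h' : J -> K) :
  cancel h h' -> cancel h' h -> monochromatic_family J -> monochromatic_family K.
Proof.
move=> hK h'K mJ T I V E c C E0 cC dK.
have hbij : bijective h by exists h'.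
have h'bij : bijective h' by exists h.
have [i|F [F1 F2 F3 F4]] := mJ T I V E c C E0 cC.
  apply/forallP => Y; apply/implyP => /balanced_freeP[h1 h2 h3 h4].
  have := dK i => /forallP/(_ [ffun k => Y (h k)])/implyP.
  rewrite (bij_eq_card hbij) (reindex h) /=; last exact: onW_bij.
  under eq_bigr do rewrite ffunE.
  apply; apply/balanced_freeP; split=> [j|j k jk|j e|j k]; rewrite !ffunE //.
    by apply: h2; rewrite (can_eq hK).
  exact: h3.
exists [ffun k => F (h k)]; split=> [j i|j i|j k i jk|j k]; rewrite !ffunE //.
  by apply: F3; rewrite (can_eq hK).
Qed.

Lemma monochromatic_family_card (J K : finType) :
  #|J| = #|K| -> monochromatic_family J -> monochromatic_family K.
Proof.
move=> eJK; apply: (@monochromatic_family_bij J K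
  (fun k => enum_val (cast_ord (esym eJK) (enum_rank k)))
  (fun j => enum_val (cast_ord eJK (enum_rank j)))) => x.
  by rewrite enum_valK cast_ordKV enum_rankK.
by rewrite enum_valK cast_ordK enum_rankK.
Qed.

(** If an entry of column [k] exceeded an entry [m] of column [k'] by two, column [k] would have all
    entries at least [m + 1] and one at least [m + 2], column [k'] all entries at most [m + 1] and
    one equal to [m]: the column sums would differ by two. *)
Lemma balanced_uncurry (J K : finType) (a : J -> K -> nat) :
  (forall k j j', a j k <= (a j' k).+1)%N ->
  (forall k k', \sum_j a j k <= (\sum_j a j k').+1)%N ->
  forall j j' k k', (a j k <= (a j' k').+1)%N.
Proof.
move=> ha hs j j' k k'; rewrite leqNgt; apply/negP => lt_a.
have := hs k k'; rewrite leqNgt => /negP; apply.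
apply: (@leq_trans (\sum_(i : J) (a j' k').+1).+1).
  rewrite ltnS (bigD1 j') //= [in X in (_ <= X)%N](bigD1 j') //= addSn ltnS.
  by rewrite leq_add2l; apply: leq_sum => i _; exact: ha.
rewrite (bigD1 j) //= [in X in (_ <= X)%N](bigD1 j) //= -addSn.
apply: leq_add => //; apply: leq_sum => i _.
by rewrite -ltnS; apply: leq_trans lt_a _; exact: ha.
Qed.

Lemma monochromatic_family_prod (J K : finType) : (0 < #|J|)%N -> (0 < #|K|)%N ->
  monochromatic_family J -> monochromatic_family K ->
  monochromatic_family (J * K)%type.
Proof.
move=> J0 K0 mJ mK T I V E c C E0 cC dJK.
have /card_gt0P[j0 _] := J0.
(* The sets to which the property for [J] applies serve as edges for the property for [K]. *)
pose E' i := [set A : {set T} | (A \subset V i) && defect_gt J (E i) A ((#|J| - 1) * C)].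
pose good (A : {ffun I -> {set T}}) (F : {ffun J -> {ffun I -> {set T}}}) :=
  [&& [forall j, forall i, F j i \in E i], [forall j, forall i, F j i \subset A i],
      [forall j, forall k, forall i, (j != k) ==> [disjoint F j i & F k i]]
    & [forall j, forall k, c (F j) == c (F k)]].
have goodP (A : {ffun I -> {set T}}) (F : {ffun J -> {ffun I -> {set T}}}) :
  reflect [/\ forall j i, F j i \in E i, forall j i, F j i \subset A i,
        forall j k i, j != k -> [disjoint F j i & F k i]
      & forall j k, c (F j) = c (F k)] (good A F).
  apply: (iffP and4P) => [] [h1 h2 h3 h4]; split.
  - by move=> j i; move/forallP/(_ j)/forallP: h1.
  - by move=> j i; move/forallP/(_ j)/forallP: h2.
  - by move=> j k i; move/forallP/(_ j)/forallP/(_ k)/forallP/(_ i)/implyP: h3.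
  - by move=> j k; move/forallP/(_ j)/forallP/(_ k)/eqP: h4.
  - by apply/forallP => j; apply/forallP => i; exact: h1.
  - by apply/forallP => j; apply/forallP => i; exact: h2.
  - apply/forallP => j; apply/forallP => k; apply/forallP => i; apply/implyP; exact: h3.
  - by apply/forallP => j; apply/forallP => k; apply/eqP; exact: h4.
pose sel A := odflt [ffun=> [ffun=> set0]] [pick F | good A F].
have selP (A : {ffun I -> {set T}}) : (forall i, A i \in E' i) -> good A (sel A).
  move=> AE; rewrite /sel; case: pickP => //= noF.
  have [F FE FA|i|F /goodP] := mJ T I A E c C E0.
  - apply: cC => // i; apply: subset_trans (FA i) _.
    by have := AE i; rewrite inE => /andP[].
  - by have := AE i; rewrite inE => /andP[].
  - by rewrite noF.
have E'0 i : set0 \notin E' i.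
  by rewrite inE; apply/nandP; right; apply/negP => /(defect_gt_card (E0 i)); rewrite cards0.
(* A tuple of derived edges gets the common color of its selected family, read off at [j0]. *)
have [F FE FV|i|G [G1 G2 G3 G4]] := mK T I V E' (fun A => c (sel A j0)) C E'0.
- have /goodP[h1 h2 _ _] := selP F FE; apply: cC => // i.
  exact: subset_trans (h2 _ _) (FV i).
- apply/forallP => Y; apply/implyP => /balanced_freeP[h1 h2 h3 h4].
  pose d := ((#|J| - 1) * C)%N.
  (* [Y k] is not a derived edge, so a balanced free family misses at most [d] of its vertices.
     Shrinking it to exactly [#|Y k| - d] makes the totals as balanced as the sizes of the [Y k]. *)
  have exZ k : exists Z : {ffun J -> {set T}},
      balanced_free (E i) (Y k) Z && (\sum_j #|Z j| == #|Y k| - d)%N.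
    have : ~~ defect_gt J (E i) (Y k) d.
      apply/negP => dY; have := h3 k (Y k); rewrite subxx inE h1 dY => /(_ isT).
      by [].
    rewrite negb_forall => /existsP[Z]; rewrite negb_imply -leqNgt => /andP[bZ sZ].
    have [|Z' bZ' sZ'] := balanced_free_shrink bZ (s := #|Y k| - d).
      by rewrite leq_subLR addnC.
    by exists Z'; rewrite bZ' sZ' eqxx.
  pose Z k := xchoose (exZ k).
  have bZ k : balanced_free (E i) (Y k) (Z k) by have /andP[] := xchooseP (exZ k).
  have sZ k : (\sum_j #|Z k j| = #|Y k| - d)%N.
    by have /andP[_ /eqP] := xchooseP (exZ k).
  have := dJK i => /forallP/(_ [ffun x => Z x.2 x.1])/implyP.
  have bal : balanced_free (E i) (V i) [ffun x : J * K => Z x.2 x.1].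
    apply/balanced_freeP; split.
    + move=> [j k]; rewrite ffunE /=; have [z1 _ _ _] := balanced_freeP _ _ _ (bZ k).
      exact: subset_trans (z1 j) (h1 k).
    + move=> [j k] [j' k']; rewrite !ffunE /= => jk.
      have [z1 z2 _ _] := balanced_freeP _ _ _ (bZ k).
      have [w1 _ _ _] := balanced_freeP _ _ _ (bZ k').
      have [ek|nk] := eqVneq k k'.
        by rewrite -ek; apply: z2; apply: contraNneq jk => ->; rewrite ek.
      apply: disjointWl (z1 j) _; apply: disjointWr (w1 j') _; exact: h2.
    + move=> [j k] e eE; rewrite ffunE /=.
      by have [_ _ z3 _] := balanced_freeP _ _ _ (bZ k); exact: z3.
    + move=> [j k] [j' k']; rewrite !ffunE /=.
      apply: (@balanced_uncurry _ _ (fun j k => #|Z k j|)) => [k1 j1 j2|k1 k2].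
        by have [_ _ _ z4] := balanced_freeP _ _ _ (bZ k1); exact: z4.
      rewrite !sZ; apply: leq_trans (leq_sub2r d (h4 k1 k2)) _.
      by rewrite leq_subLR addnS ltnS -leq_subLR.
  move=> /(_ bal); apply: leq_ltn_trans.
  under [X in (_ <= X + _)%N]eq_bigr do rewrite ffunE.
  rewrite -(pair_bigA _ (fun j k => #|Z k j|)) exchange_big /=.
  under [X in (_ <= X + _)%N]eq_bigr do rewrite sZ.
  have : (\sum_k #|Y k| <= \sum_k (#|Y k| - d) + #|K| * d)%N.
    rewrite -sum_nat_const -big_split /=; apply: leq_sum => k _.
    by rewrite addnC -leq_subLR.
  rewrite card_prod => leY; apply: leq_trans (leq_add leY (leqnn _)) _.
  (* The constants fit: [#|K| * (#|J| - 1) + (#|K| - 1) = #|J| * #|K| - 1]. *)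
  rewrite -addnA leq_add2l /d mulnA -mulnDl leq_mul2r; apply/orP; right.
  move: J0 K0; case: #|J| => // a; case: #|K| => // b _ _; rewrite !subn1 /=.
  by rewrite addnC mulnC; exact: leqnn.
pose F : {ffun J * K -> {ffun I -> {set T}}} := [ffun x => sel (G x.2) x.1].
have GE k : good (G k) (sel (G k)) by apply: selP => i; exact: G1.
exists F; split.
- by move=> [j k] i; rewrite ffunE /=; have /goodP[h _ _ _] := GE k; exact: h.
- move=> [j k] i; rewrite ffunE /=; have /goodP[_ h _ _] := GE k.
  exact: subset_trans (h j i) (G2 k i).
- move=> [j k] [j' k'] i jk; rewrite !ffunE /=.
  have /goodP[_ h2 h3 _] := GE k; have /goodP[_ h2' _ _] := GE k'.
  have [ek|nk] := eqVneq k k'.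
    by rewrite -ek; apply: h3; apply: contraNneq jk => ->; rewrite ek.
  apply: disjointWl (h2 j i) _; apply: disjointWr (h2' j' i) _; exact: G3.
move=> [j k] [j' k']; rewrite !ffunE /=.
have /goodP[_ _ _ h] := GE k; have /goodP[_ _ _ h'] := GE k'.
by rewrite (h j j0) (h' j' j0); exact: G4.
Qed.

(** * The prime case *)

Section TranslationSign.
Variable p : nat.
Hypothesis p_pr : prime p.
Implicit Types (B : {set 'F_p}) (L : seq {set 'F_p}).

Definition translate (g : 'F_p) B : {set 'F_p} := [set b + g | b in B].

Lemma mem_translate g B x : (x \in translate g B) = (x - g \in B).
Proof.
apply/imsetP/idP => [[b bB ->]|xB]; first by rewrite addrK.
by exists (x - g); rewrite ?subrK.
Qed.

Lemma translate0 g : translate g set0 = set0.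
Proof. by apply/setP => x; rewrite mem_translate !inE. Qed.

Lemma translate_eq0 g B : (translate g B == set0) = (B == set0).
Proof. by rewrite -!cards_eq0 card_imset //; exact: addIr. Qed.

Definition nontrivial B := (B != set0) && (B != setT).

Lemma nontrivial_translate g B : nontrivial (translate g B) = nontrivial B.
Proof.
rewrite /nontrivial translate_eq0 !eqEcard !subsetT !cardsT /=.
by rewrite card_imset //; exact: addIr.
Qed.

Definition barycenter B : 'F_p := (\sum_(b in B) b) / #|B|%:R.

(* The cardinal of B is invertible because p is prime and 0 < #|B| < p. *)
Lemma barycenter_translate g B :
  nontrivial B -> barycenter (translate g B) = barycenter B + g.
Proof.
move=> /andP[B0 BT].
have Bp : (#|B|%:R : 'F_p) != 0.
  rewrite -(dvdn_pcharf (pchar_Fp p_pr)) gtnNdvd ?card_gt0 // -[X in (_ < X)%N](card_Fp p_pr).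
  by rewrite -cardsT; apply: proper_card; rewrite properEneq BT subsetT.
have inj : injective (fun b : 'F_p => b + g) by exact: addIr.
rewrite /barycenter /translate big_imset /=; last by move=> ? ? _ _; exact: inj.
rewrite card_imset // big_split /= sumr_const mulrDl -[g *+ _]mulr_natr.
by rewrite mulfK.
Qed.

Definition first_sign L := barycenter (nth set0 L (find nontrivial L)).

Lemma first_sign_translate g L :
  has nontrivial L -> first_sign (map (translate g) L) = first_sign L + g.
Proof.
move=> hL; rewrite /first_sign find_map (eq_find (nontrivial_translate g)).
by rewrite (nth_map set0) -?has_find // barycenter_translate // nth_find.
Qed.

Lemma first_sign_cat L1 L2 :
  first_sign (L1 ++ L2) = if has nontrivial L1 then first_sign L1 else first_sign L2.
Proof.
rewrite /first_sign find_cat nth_cat; case: (boolP (has _ L1)) => hL; first by rewrite -has_find hL.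
by rewrite ltnNge leq_addr addKn.
Qed.

End TranslationSign.

(** * Balanced truncation of a vector of sizes *)

Section TruncatedProfile.
Local Open Scope nat_scope.
Variables (J : finType) (j0 : J).
Implicit Types a b z : J -> nat.

Lemma eq_sum_le a b :
  (forall j, a j <= b j) -> \sum_j a j = \sum_j b j -> forall j, a j = b j.
Proof.
move=> ab sab.
have [_] := @leqif_sum J xpredT (fun i => a i == b i) a b (fun i _ => leqif_eq (ab i)).
by rewrite sab eqxx => /esym/forall_inP eq_ab j; apply/eqP; exact: eq_ab.
Qed.

Definition min_value a : nat := a [arg min_(k < j0) a k].

(** The largest vector below [a] whose entries differ by at most 1 ([truncated_balanced],
    [balanced_le_truncated]). *)
Definition truncated a j : nat := minn (a j) (min_value a).+1.

Lemma min_value_le a k : min_value a <= a k.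
Proof. by rewrite /min_value; case: arg_minnP => // i _; exact. Qed.

Lemma min_value_le_truncated a k : min_value a <= truncated a k.
Proof. by rewrite leq_min min_value_le leqnSn. Qed.

Lemma le_truncated a b j : (forall k, a k <= b k) -> truncated a j <= truncated b j.
Proof.
move=> ab; have m_ab : min_value a <= min_value b.
  by rewrite [min_value b]/min_value; apply: leq_trans (ab _); exact: min_value_le.
by rewrite leq_min !geq_min ab ltnS m_ab orbT.
Qed.

Lemma truncated_balanced a j k : truncated a j <= (truncated a k).+1.
Proof. by rewrite geq_min ltnS min_value_le_truncated orbT. Qed.

Lemma balanced_le_truncated a z j :
  (forall k, z k <= a k) -> (forall k l, z k <= (z l).+1) -> z j <= truncated a j.
Proof.
move=> za zb; rewrite leq_min za; apply: leq_trans (zb _ _) _.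
by rewrite ltnS; exact: za.
Qed.

(** Truncation leaves the minimal entries and puts all others one above, so it remembers where the
    minimum is attained. *)
Lemma min_truncated a j :
  (forall k, a j <= a k) <-> (forall k, truncated a j <= truncated a k).
Proof.
split=> le_j k.
  have -> : truncated a j = min_value a.
    have aj : a j = min_value a by apply/eqP; rewrite eqn_leq le_j min_value_le.
    by rewrite /truncated aj; apply/minn_idPl.
  exact: min_value_le_truncated.
apply: leq_trans (min_value_le a k).
have := le_j [arg min_(k < j0) a k]; rewrite {2}/truncated -/(min_value a).
by rewrite (minn_idPl (leqnSn _)) geq_min ltnn orbF.
Qed.

Lemma truncated_const a j : (forall k, a j <= a k) -> truncated a j = a j.
Proof.
move=> le_j; apply/minn_idPl; apply: leq_trans (leqnSn _); exact: le_j.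
Qed.

End TruncatedProfile.

(** * Levels and signs of vectors, for prime [p] *)

Section PrimeCase.
Local Open Scope nat_scope.
Variables (p : nat) (T I : finType) (V : I -> {set T}) (E : I -> {set {set T}}).
Variables (c : {ffun I -> {set T}} -> nat) (C : nat) (i0 : I).
Local Notation D := ((#|'F_p| - 1) * C).
Hypothesis p_pr : prime p.
Hypothesis C_gt0 : 0 < C.
Hypothesis E0 : forall i, set0 \notin E i.
Hypothesis c_ltC : forall F : {ffun I -> {set T}},
  (forall i, F i \in E i) -> (forall i, F i \subset V i) -> c F < C.
Hypothesis defectV : forall i, defect_gt 'F_p (E i) (V i) D.
Hypothesis no_monochromatic : forall F : {ffun 'F_p -> {ffun I -> {set T}}},
  (forall j i, F j i \in E i) -> (forall j i, F j i \subset V i) ->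
  (forall j k i, j != k -> [disjoint F j i & F k i]) ->
  ~ (forall j k, c (F j) = c (F k)).

Let W := (I * T)%type.
Let ws : seq W := enum [set w : W | w.2 \in V w.1].
Local Notation cells := {set W * 'F_p}.
Implicit Types X Y : cells.

Definition part X i j : {set T} := [set v | ((i, v), j) \in X].

Definition full_signs X i : {set 'F_p} :=
  [set j | [exists e in E i, e \subset part X i j]].

Definition min_signs X i : {set 'F_p} :=
  if full_signs X i == set0
  then [set j | [forall k, #|part X i j| <= #|part X i k|]] else set0.

Definition color_signs X (k : 'I_C) : {set 'F_p} :=
  [set j | [exists F : {ffun I -> {set T}},
     [forall i, (F i \in E i) && (F i \subset part X i j)] && (c F == k)]].

Definition free_families X i : {set {ffun 'F_p -> {set T}}} :=
  [set Z : {ffun 'F_p -> {set T}} |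
     balanced_free (E i) (V i) Z && [forall j, Z j \subset part X i j]].

Definition max_free X i : nat :=
  \max_(Z in free_families X i) \sum_j #|Z j|.

(** Passing to the first case is a strict increase by [full_max_free]; in the second, [defectV]
    leaves room below [#|V i|]. *)
Definition coord_level X i : nat :=
  if full_signs X i == setT then \sum_j #|part X i j|
  else max_free X i + #|full_signs X i|.

Definition colorless X := [forall k, color_signs X k == set0].

(** The offset bounds all colorless levels ([colorless_level]), and the at most [D] signs counted
    over all colors still fit below the number of vertices. *)
Definition level X : nat :=
  if colorless X then \sum_i coord_level X i
  else (\sum_i #|V i| - D.+1) + \sum_k #|color_signs X k|.

(** Listed by priority. The last sets, singletons or empty for a signed [X], decide only when the
    full and minimal signs are trivial in every coordinate. *)
Definition sign_sets X : seq {set 'F_p} :=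
  if colorless X then
    [seq full_signs X i | i <- enum I] ++ [seq min_signs X i | i <- enum I] ++
      [seq [set j | (w, j) \in X] | w <- enum {: W}]
  else [seq color_signs X k | k <- enum 'I_C].

Lemma card_Fp_gt0 : 0 < #|'F_p|.
Proof. by apply/card_gt0P; exists 0%R. Qed.

Lemma partS X Y i j : X \subset Y -> part X i j \subset part Y i j.
Proof. by move=> XY; apply/subsetP => v; rewrite !inE; exact: subsetP. Qed.

Lemma full_signsS X Y i : X \subset Y -> full_signs X i \subset full_signs Y i.
Proof.
move=> XY; apply/subsetP => j; rewrite !inE => /exists_inP[e eE eX].
by apply/exists_inP; exists e => //; apply: subset_trans eX (partS _ _ XY).
Qed.

Lemma color_signsS X Y k : X \subset Y -> color_signs X k \subset color_signs Y k.
Proof.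
move=> XY; apply/subsetP => j; rewrite !inE => /existsP[F /andP[/forallP FX cF]].
apply/existsP; exists F; rewrite cF andbT; apply/forallP => i.
have /andP[-> FXi] := FX i; exact: subset_trans FXi (partS _ _ XY).
Qed.

Lemma max_freeS X Y i : X \subset Y -> max_free X i <= max_free Y i.
Proof.
move=> XY; apply/bigmax_leqP => Z; rewrite inE => /andP[bZ /forallP ZX].
apply: (leq_bigmax_cond Z).
by rewrite inE bZ; apply/forallP => j; apply: subset_trans (ZX j) (partS _ _ XY).
Qed.

Lemma max_free_attained X i :
  exists2 Z, Z \in free_families X i & max_free X i = \sum_j #|Z j|.
Proof.
have [|Z ZX eZ] := @eq_bigmax_cond _ (mem (free_families X i))
  (fun Z : {ffun 'F_p -> {set T}} => \sum_j #|Z j|); last by exists Z.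
apply/card_gt0P; exists [ffun=> set0]; rewrite /= inE balanced_free0 //.
by apply/forallP => j; rewrite ffunE sub0set.
Qed.

Lemma max_free_defect X i : max_free X i + D < #|V i|.
Proof.
have [Z] := max_free_attained X i; rewrite inE => /andP[bZ _] ->.
by have /forallP/(_ Z)/implyP := defectV i; exact.
Qed.

(** A free class contains no edge while its part does, so each class misses a vertex of its part. *)
Lemma full_max_free X i :
  full_signs X i = setT -> max_free X i + #|'F_p| <= \sum_j #|part X i j|.
Proof.
have [Z] := max_free_attained X i; rewrite inE => /andP[bZ /forallP ZX] -> AT.
rewrite -sum1_card -big_split /=; apply: leq_sum => j _; rewrite addn1.
apply: proper_card; rewrite properEneq ZX andbT; apply/eqP => ZE.
have : j \in full_signs X i by rewrite AT inE.
rewrite inE => /exists_inP[e eE]; rewrite -ZE.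
by have [_ _ /(_ j e eE)/negPf ->] := balanced_freeP _ _ _ bZ.
Qed.

Section SignedSet.
Variable X : cells.
Hypothesis signedX : signed_set ws X.

Lemma part_subV i j : part X i j \subset V i.
Proof.
have /and3P[_ /forall_inP Xw _] := signedX.
by apply/subsetP => v; rewrite inE => /Xw /=; rewrite mem_enum inE.
Qed.

Lemma part_disjoint i j k : j != k -> [disjoint part X i j & part X i k].
Proof.
have /and3P[_ _ /forall_inP Xf] := signedX => jk.
rewrite -setI_eq0; apply/eqP/setP => v; rewrite !inE; apply/negP => /andP[vj vk].
have /forall_inP/(_ _ vk) := Xf _ vj; rewrite eqxx /= => /eqP[ejk].
by rewrite ejk eqxx in jk.
Qed.

Lemma sum_part_le i : \sum_j #|part X i j| <= #|V i|.
Proof.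
under eq_bigr do rewrite -sum1_card.
rewrite -partition_disjoint_bigcup; last by move=> j k; exact: part_disjoint.
by rewrite sum1_card subset_leq_card //; apply/bigcupsP => j _; exact: part_subV.
Qed.

(** No part contains an edge, so only balance bounds the classes; cutting the parts to the truncated
    sizes attains the bound. *)
Lemma max_free_truncated i : full_signs X i = set0 ->
  max_free X i = \sum_j truncated (0%R : 'F_p) (fun j => #|part X i j|) j.
Proof.
move=> AX; apply/eqP; rewrite eqn_leq; apply/andP; split.
  apply/bigmax_leqP => Z; rewrite inE => /andP[bZ /forallP ZX].
  have [_ _ _ Zb] := balanced_freeP _ _ _ bZ.
  apply: leq_sum => j _; apply: (@balanced_le_truncated _ _ _ (fun j => #|Z j|)) => //.
  by move=> k; exact: subset_leq_card.
pose u := truncated (0%R : 'F_p) (fun j => #|part X i j|).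
pose Z : {ffun 'F_p -> {set T}} := [ffun j => [set v in take (u j) (enum (part X i j))]].
have ZX j : Z j \subset part X i j.
  by apply/subsetP => v; rewrite ffunE inE => /mem_take; rewrite mem_enum.
have Zu j : #|Z j| = u j.
  rewrite ffunE cardsE (card_uniqP _) ?take_uniq ?enum_uniq //.
  by rewrite size_take -cardE; case: ltnP => // le_u; apply/eqP; rewrite eqn_leq le_u geq_min leqnn.
rewrite -[X in X <= _](eq_bigr _ (fun j _ => Zu j)).
apply: (leq_bigmax_cond Z).
rewrite inE; apply/andP; split; last exact/forallP.
apply/balanced_freeP; split.
- by move=> j; apply: subset_trans (ZX j) (part_subV _ _).
- move=> j k jk; apply: disjointWl (ZX j) _; apply: disjointWr (ZX k) _.
  exact: part_disjoint.
- move=> j e eE; apply/negP => eZ; have : j \notin full_signs X i by rewrite AX inE.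
  by rewrite inE => /exists_inP; apply; exists e => //; apply: subset_trans eZ (ZX j).
by move=> j k; rewrite !Zu; exact: truncated_balanced.
Qed.

(** Otherwise one tuple for each sign would form a monochromatic family, disjoint because the parts
    are. *)
Lemma color_signs_neqT k : color_signs X k != setT.
Proof.
apply/eqP => ST; pose good j (F : {ffun I -> {set T}}) :=
  [forall i, (F i \in E i) && (F i \subset part X i j)] && (c F == k).
have exF j : exists F, good j F.
  by apply/existsP; have := in_setT j; rewrite -ST inE.
pose F : {ffun 'F_p -> {ffun I -> {set T}}} := [ffun j => xchoose (exF j)].
have FP j : good j (F j) by rewrite ffunE; exact: (xchooseP (exF j)).
have FE j i : F j i \in E i by have /andP[/forallP/(_ i)/andP[]] := FP j.
have FX j i : F j i \subset part X i j by have /andP[/forallP/(_ i)/andP[]] := FP j.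
have Fc j : c (F j) = k by have /andP[_ /eqP] := FP j.
apply: (@no_monochromatic F) => //.
- by move=> j i; apply: subset_trans (FX j i) (part_subV _ _).
- move=> j j' i jj'; apply: disjointWl (FX j i) _; apply: disjointWr (FX j' i) _.
  exact: part_disjoint.
by move=> j j'; rewrite !Fc.
Qed.

(** A sign full in every coordinate yields a tuple of edges, which has a color. *)
Lemma colorless_bigcup : colorless X -> \bigcup_i ~: full_signs X i = setT.
Proof.
move=> /forallP S0; apply/eqP; rewrite eqEsubset subsetT; apply/subsetP => j _.
apply: contraT => jA.
have exe i : exists e, (e \in E i) && (e \subset part X i j).
  apply/existsP; apply: contraR jA => nj.
  by apply/bigcupP; exists i; rewrite // !inE.
pose F : {ffun I -> {set T}} := [ffun i => xchoose (exe i)].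
have FP i : (F i \in E i) && (F i \subset part X i j) by rewrite ffunE; exact: (xchooseP (exe i)).
have cF : c F < C.
  apply: c_ltC => i; have /andP[// FE FX] := FP i.
  exact: subset_trans FX (part_subV _ _).
have : j \in color_signs X (Ordinal cF).
  by rewrite inE; apply/existsP; exists F; rewrite eqxx andbT; exact/forallP.
by rewrite (eqP (S0 _)) inE.
Qed.

Lemma D_ge_card : #|'F_p| <= D.+1.
Proof. by rewrite -ltnS; case: #|'F_p| => // n; rewrite subn1 /= !ltnS leq_pmulr. Qed.

(** Coordinate [i] leaves a gap of at least the number [x i] of its signs that are not full, plus
    [D.+1 - #|'F_p|] if there are any. The [x i] add up to at least [#|'F_p|], so the extra term
    occurs at least once. *)
Lemma colorless_level : colorless X -> \sum_i coord_level X i + D.+1 <= \sum_i #|V i|.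
Proof.
move=> S0; have UT := colorless_bigcup S0.
pose x i := #|~: full_signs X i|.
have x_ge : #|'F_p| <= \sum_i x i.
  rewrite -[X in X <= _]cardsT -UT; elim/big_rec2: _ => [|i n B _ Bn]; first by rewrite cards0.
  by apply: leq_trans (leq_card_setU _ _) _; rewrite leq_add2l.
have [i1 Ai1] : exists i, full_signs X i != setT.
  apply/existsP; apply: contraTT x_ge; rewrite negb_exists => /forallP AT.
  rewrite big1 -?ltnNge ?card_Fp_gt0 // => i _.
  by have := AT i; rewrite negbK /x => /eqP ->; rewrite setCT cards0.
pose y i := if full_signs X i == setT then 0 else D.+1 - #|'F_p|.
have coordP i : coord_level X i + (x i + y i) <= #|V i|.
  rewrite /coord_level /x /y; case: eqP => [->|_].
    by rewrite setCT cards0 !addn0; exact: sum_part_le.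
  rewrite addnA -[X in X + _]addnA cardsC -addnA subnKC ?D_ge_card // addnS.
  exact: max_free_defect.
have le_sum : \sum_i (coord_level X i + (x i + y i)) <= \sum_i #|V i|.
  by apply: leq_sum => i _; exact: coordP.
apply: leq_trans le_sum; rewrite !big_split /= leq_add2l.
rewrite -(subnKC D_ge_card); apply: leq_add => //.
by rewrite (bigD1 i1) //= {1}/y (negPf Ai1) leq_addr.
Qed.

Lemma D_ltV : D < \sum_i #|V i|.
Proof.
by rewrite (bigD1 i0) //=; apply: leq_trans (defect_gt_card (E0 i0) (defectV i0)) (leq_addr _ _).
Qed.

Lemma level_le : level X <= (\sum_i #|V i|).-1.
Proof.
have DV := D_ltV; rewrite /level; case: ifP => [S0|_].
  rewrite -ltnS prednK; last exact: leq_ltn_trans DV.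
  apply: leq_trans (colorless_level S0); rewrite addnS ltnS; exact: leq_addr.
rewrite -ltnS prednK; last exact: leq_ltn_trans DV.
apply: leq_trans (_ : (\sum_i #|V i| - D.+1) + D.+1 <= _); last by rewrite subnK.
rewrite addnS ltnS leq_add2l mulnC -[X in _ <= X * _]card_ord -sum_nat_const.
apply: leq_sum => k _; rewrite leq_subRL ?add1n; last exact: card_Fp_gt0.
rewrite -cardsT; apply: proper_card; rewrite properEneq subsetT andbT.
exact: color_signs_neqT.
Qed.

Lemma level_gt0 : 0 < level X.
Proof.
have /and3P[/set0Pn[[[i v] j] vX] _ _] := signedX.
rewrite /level; case: ifP => [_|/negbT]; last first.
  rewrite negb_forall => /existsP[k Sk]; rewrite (bigD1 k) //=.
  by apply: leq_trans (leq_addl _ _); apply: leq_trans (leq_addr _ _); rewrite card_gt0.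
rewrite (bigD1 i) //=; apply: leq_trans (leq_addr _ _); rewrite /coord_level.
have vp : 0 < #|part X i j| by apply/card_gt0P; exists v; rewrite inE.
case: ifP => _; first by rewrite (bigD1 j) //=; apply: leq_trans (leq_addr _ _).
have [AX|A0] := eqVneq (full_signs X i) set0; last first.
  by apply: leq_trans (leq_addl _ _); rewrite card_gt0.
apply: leq_trans (leq_addr _ _); rewrite max_free_truncated // (bigD1 j) //=.
by apply: leq_trans (leq_addr _ _); rewrite leq_min vp.
Qed.

End SignedSet.

Lemma eq_parts X Y i : X \subset Y ->
  \sum_j #|part X i j| = \sum_j #|part Y i j| -> forall j, part X i j = part Y i j.
Proof.
move=> XY sXY j; apply/eqP; rewrite eqEcard partS //=.
by rewrite (eq_sum_le (fun k => subset_leq_card (partS i k XY)) sXY).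
Qed.

(** Let the levels agree. If all signs are full, the vertex counts and hence the parts agree. If
    only some are, they form a nontrivial set. If none is, the truncated sizes agree and fix the
    minimal signs; when every sign is minimal, truncation changes no size. *)
Lemma coord_level_mono X Y i : signed_set ws X -> signed_set ws Y -> X \subset Y ->
  coord_level X i <= coord_level Y i /\
  (coord_level X i = coord_level Y i ->
   [/\ full_signs X i = full_signs Y i, min_signs X i = min_signs Y i
     & ~~ nontrivial (full_signs X i) -> ~~ nontrivial (min_signs X i) ->
       forall j, part X i j = part Y i j]).
Proof.
move=> sX sY XY; have AXY := full_signsS i XY; have mXY := max_freeS i XY.
have cXY j : #|part X i j| <= #|part Y i j| by rewrite subset_leq_card ?partS.
have T0 : ([set: 'F_p] == set0) = false by apply/negbTE/set0Pn; exists 0%R.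
rewrite /coord_level; case: (eqVneq (full_signs X i) setT) => AX.
  have AY : full_signs Y i = setT by apply/eqP; rewrite eqEsubset subsetT -AX.
  rewrite AY eqxx; split; first by apply: leq_sum => j _.
  move=> sXY; rewrite AX /min_signs AX AY T0; split=> // _ _.
  exact: eq_parts.
case: (eqVneq (full_signs Y i) setT) => AY.
  suff lt : max_free X i + #|full_signs X i| < \sum_j #|part Y i j|.
    by split; [exact: ltnW|move=> e; rewrite e ltnn in lt].
  apply: leq_trans (full_max_free AY); rewrite -addnS; apply: leq_add => //.
  by rewrite -cardsT proper_card // properEneq AX subsetT.
have cA := subset_leq_card AXY; split; first exact: leq_add.
move=> e; have cE : #|full_signs X i| = #|full_signs Y i|.
  apply/eqP; rewrite eqn_leq cA /= -(leq_add2l (max_free X i)) e leq_add2r.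
  exact: mXY.
have AE : full_signs X i = full_signs Y i by apply/eqP; rewrite eqEcard AXY cE /=.
have mE : max_free X i = max_free Y i by move/eqP: e; rewrite cE eqn_add2r => /eqP.
have [A0|A0] := eqVneq (full_signs X i) set0; last first.
  split=> //; first by rewrite /min_signs -AE (negPf A0).
  by rewrite /nontrivial A0 AX.
have AY0 : full_signs Y i = set0 by rewrite -AE.
pose uX := truncated (0%R : 'F_p) (fun j => #|part X i j|).
pose uY := truncated (0%R : 'F_p) (fun j => #|part Y i j|).
have uE : forall j, uX j = uY j.
  apply: eq_sum_le; first by move=> j; exact: le_truncated.
  by rewrite -(max_free_truncated sX A0) -(max_free_truncated sY AY0).
have minE j : (forall k, #|part X i j| <= #|part X i k|) <->
              (forall k, #|part Y i j| <= #|part Y i k|).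
  have tX : (forall k, #|part X i j| <= #|part X i k|) <-> (forall k, uX j <= uX k).
    exact: min_truncated.
  have tY : (forall k, #|part Y i j| <= #|part Y i k|) <-> (forall k, uY j <= uY k).
    exact: min_truncated.
  by split=> [/tX h|/tY h]; [apply/tY|apply/tX] => k; have := h k; rewrite !uE.
have BE : min_signs X i = min_signs Y i.
  rewrite /min_signs A0 AY0 eqxx; apply/setP => j; rewrite !inE.
  by apply/forallP/forallP => /minE.
split=> // _ ntB j.
(* Some sign is minimal, so a trivial [min_signs X i] contains every sign. *)
have jB : j \in min_signs X i.
  suff -> : min_signs X i = setT by rewrite inE.
  apply/eqP; move: ntB; rewrite /nontrivial negb_and !negbK => /orP[/eqP B0|//].
  have : [arg min_(k < (0%R : 'F_p)) #|part X i k|] \in min_signs X i.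
    rewrite /min_signs A0 eqxx inE; apply/forallP => k.
    by case: arg_minnP => // k' _; exact.
  by rewrite B0 inE.
have jmin : forall k, #|part X i j| <= #|part X i k|.
  by move: jB; rewrite /min_signs A0 eqxx inE => /forallP.
apply/eqP; rewrite eqEcard partS //=.
rewrite -(@truncated_const _ (0%R : 'F_p) (fun j => #|part X i j|) j) //.
rewrite -(@truncated_const _ (0%R : 'F_p) (fun j => #|part Y i j|) j); last exact/minE.
by rewrite -/(uX j) -/(uY j) uE.
Qed.

Lemma part_shift g X i j : part (shift_set g X) i j = part X i (j - g)%R.
Proof. by apply/setP => v; rewrite !inE mem_shift_set. Qed.

Lemma color_signs_shift g X k :
  color_signs (shift_set g X) k = translate g (color_signs X k).
Proof.
apply/setP => j; rewrite mem_translate !inE; apply: eq_existsb => F.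
by congr (_ && _); apply: eq_forallb => i; rewrite part_shift.
Qed.

Lemma full_signs_shift g X i :
  full_signs (shift_set g X) i = translate g (full_signs X i).
Proof. by apply/setP => j; rewrite mem_translate !inE part_shift. Qed.

Lemma min_signs_shift g X i :
  min_signs (shift_set g X) i = translate g (min_signs X i).
Proof.
rewrite /min_signs full_signs_shift translate_eq0; case: ifP => _; last by rewrite translate0.
apply/setP => j; rewrite mem_translate !inE; apply/forallP/forallP => h k.
  by have := h (k + g)%R; rewrite !part_shift addrK.
by rewrite !part_shift.
Qed.

Lemma colorless_shift g X : colorless (shift_set g X) = colorless X.
Proof. by apply: eq_forallb => k; rewrite color_signs_shift translate_eq0. Qed.

Lemma sign_sets_shift g X :
  sign_sets (shift_set g X) = map (translate g) (sign_sets X).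
Proof.
rewrite /sign_sets colorless_shift; case: ifP => _; rewrite ?map_cat -!map_comp.
  congr (_ ++ (_ ++ _)); apply: eq_map => x /=.
  - exact: full_signs_shift.
  - exact: min_signs_shift.
  - by apply/setP => j; rewrite mem_translate !inE mem_shift_set.
by apply: eq_map => k /=; exact: color_signs_shift.
Qed.

Lemma sign_sets_nontrivial X : signed_set ws X -> has (@nontrivial p) (sign_sets X).
Proof.
move=> sX; rewrite /sign_sets; case: ifP => [_|/negbT].
  rewrite !has_cat; apply/orP; right; apply/orP; right.
  have /and3P[/set0Pn[[w j] wX] _ /forall_inP Xf] := sX.
  apply/hasP; exists [set k | (w, k) \in X]; first by apply: map_f; rewrite mem_enum.
  apply/andP; split; first by apply/set0Pn; exists j; rewrite inE.
  apply/eqP => wT; have : (j + 1)%R \in [set k | (w, k) \in X] by rewrite wT inE.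
  rewrite inE => /(forall_inP (Xf _ wX)); rewrite eqxx /= => /eqP[/eqP].
  by rewrite -subr_eq0 opprD addrA subrr sub0r oppr_eq0 oner_eq0.
rewrite negb_forall => /existsP[k Sk]; apply/hasP; exists (color_signs X k).
  by apply: map_f; rewrite mem_enum.
by rewrite /nontrivial Sk color_signs_neqT.
Qed.

Lemma level_mono X Y : signed_set ws X -> signed_set ws Y -> X \subset Y ->
  level X <= level Y /\
  (level X = level Y -> first_sign (sign_sets X) = first_sign (sign_sets Y)).
Proof.
move=> sX sY XY; rewrite /level /sign_sets.
have cS : colorless Y -> colorless X.
  move=> /forallP Y0; apply/forallP => k; rewrite -subset0 -(eqP (Y0 k)).
  exact: color_signsS.
case: (boolP (colorless Y)) => [Y0|Yc]; last first.
  case: (boolP (colorless X)) => [X0|Xc].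
    (* Colorless levels do not exceed the offset, and [Y] has at least one color sign. *)
    suff lt : \sum_i coord_level X i <
        \sum_i #|V i| - D.+1 + \sum_k #|color_signs Y k|.
      by split; [exact: ltnW|move=> e; rewrite e ltnn in lt].
    rewrite -addn1; apply: leq_add.
      by rewrite leq_subRL ?D_ltV // addnC colorless_level.
    move: Yc; rewrite negb_forall => /existsP[k Sk]; rewrite (bigD1 k) //=.
    by apply: leq_trans (leq_addr _ _); rewrite card_gt0.
  have cSk k := subset_leq_card (color_signsS k XY).
  split; first by rewrite leq_add2l; apply: leq_sum => k _; exact: cSk.
  move/eqP; rewrite eqn_add2l => /eqP/(eq_sum_le cSk) SE; congr first_sign.
  by apply: eq_map => k; apply/eqP; rewrite eqEcard color_signsS //= SE.
rewrite cS //; have lev i := coord_level_mono i sX sY XY.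
split; first by apply: leq_sum => i _; exact: (lev i).1.
move=> /(eq_sum_le (fun i => (lev i).1)) levE.
have AE i : full_signs X i = full_signs Y i by have [] := (lev i).2 (levE i).
have BE i : min_signs X i = min_signs Y i by have [] := (lev i).2 (levE i).
rewrite !first_sign_cat -(eq_map AE) -(eq_map BE).
case: ifP => // /negbT; rewrite has_map -all_predC => /allP A0.
case: ifP => // /negbT; rewrite has_map -all_predC => /allP B0.
(* All sets of higher priority are trivial, so [X] and [Y] have the same parts. *)
congr first_sign; apply: eq_map => -[i v]; apply/setP => j; rewrite !inE.
have [_ _ /(_ (A0 i _) (B0 i _))] := (lev i).2 (levE i).
by rewrite !mem_enum => /(_ isT isT j)/setP/(_ v); rewrite !inE.
Qed.

Lemma no_monochromatic_absurd : False.
Proof.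
have szws : size ws = \sum_i #|V i|.
  rewrite /ws -cardE -sum1_card.
  under [RHS]eq_bigr do rewrite -sum1_card.
  rewrite (pair_big_dep xpredT (fun i v => v \in V i)) /=.
  by apply: eq_bigl => w; rewrite inE.
have V0 : 0 < \sum_i #|V i| by apply: leq_ltn_trans D_ltV.
have : size ws <= (\sum_i #|V i|).-1.
  apply: (@Zp_tucker p _ ws (fun X => first_sign (sign_sets X)) level).
  - exact: enum_uniq.
  - by move=> X g sX; rewrite sign_sets_shift first_sign_translate ?sign_sets_nontrivial.
  - by move=> X sX; rewrite level_gt0 // level_le.
  - exact: level_mono.
by rewrite szws -ltnS prednK // ltnn.
Qed.

End PrimeCase.

Lemma monochromatic_family_Fp (p : nat) : prime p -> monochromatic_family 'F_p.
Proof.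
move=> p_pr T I V E c C E0 cC dV.
pose good (F : {ffun 'F_p -> {ffun I -> {set T}}}) :=
  [&& [forall j, forall i, (F j i \in E i) && (F j i \subset V i)],
      [forall j, forall k, forall i, (j != k) ==> [disjoint F j i & F k i]]
    & [forall j, forall k, c (F j) == c (F k)]].
have [/existsP[F /and3P[/forallP h1 /forallP h2 /forallP h3]]|noF] :=
    boolP [exists F, good F].
  exists F; split=> [j i|j i|j k i jk|j k].
  - by have /forallP/(_ i)/andP[] := h1 j.
  - by have /forallP/(_ i)/andP[] := h1 j.
  - by have /forallP/(_ k)/forallP/(_ i)/implyP := h2 j; apply.
  - by have /forallP/(_ k)/eqP := h3 j.
(* Over an empty [I] all tuples are equal and the conditions on coordinates are void. *)
exfalso; have [i0|I0] := pickP (mem I); last first.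
  move/existsP: noF; apply; exists [ffun=> [ffun=> set0]]; apply/and3P; split.
  - by apply/forallP => j; apply/forallP => i; have := I0 i.
  - by apply/forallP => j; apply/forallP => k; apply/forallP => i; have := I0 i.
  - by apply/forallP => j; apply/forallP => k; rewrite !ffunE.
(* With no colors, a tuple of edges is already absurd; if some [V i] contained no edge, a balanced
   partition of it would contradict the defect. *)
case: (posnP C) => [C0 _|C_gt0 _].
  have exe i : exists e, (e \in E i) && (e \subset V i).
    apply/existsP; apply: contraT => /existsPn noe.
    have [Y bY sY] := balanced_partition (V i) (0 : 'F_p).
    have [h1 h2 _ h4] := balanced_freeP _ _ _ bY.
    have := dV i => /forallP/(_ Y)/implyP; rewrite C0 muln0 addn0 sY ltnn; apply.
    apply/balanced_freeP; split=> // j e eE; apply/negP => eY.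
    by have := noe e; rewrite eE (subset_trans eY (h1 j)).
  pose F : {ffun I -> {set T}} := [ffun i => xchoose (exe i)].
  have FP i : (F i \in E i) && (F i \subset V i).
    by rewrite ffunE; exact: (xchooseP (exe i)).
  have : (c F < C)%N by apply: cC => i; have /andP[] := FP i.
  by rewrite C0.
apply: (@no_monochromatic_absurd p T I V E c C i0) => // F h1 h2 h3 h4.
move/existsP: noF; apply; exists F; apply/and3P; split.
- by apply/forallP => j; apply/forallP => i; rewrite h1 h2.
- by apply/forallP => j; apply/forallP => k; apply/forallP => i; apply/implyP; exact: h3.
- by apply/forallP => j; apply/forallP => k; apply/eqP.
Qed.

Lemma monochromatic_family_ord (r : nat) : (1 < r)%N -> monochromatic_family 'I_r.
Proof.
elim/ltn_ind: r => r IH r_gt1; have [r_pr|] := boolP (prime r).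
  apply: (monochromatic_family_card _ (monochromatic_family_Fp r_pr)).
  by rewrite card_Fp // card_ord.
move/primePn => [|[d /andP[d_gt1 d_lt] /dvdnP[q rE]]]; first by case: r r_gt1 {IH} => [|[]].
have q_gt1 : (1 < q)%N.
  rewrite ltnNge; apply: contraL d_lt => q1.
  by rewrite -leqNgt rE -[X in (_ <= X)%N]mul1n leq_mul2r q1 orbT.
have q_lt : (q < r)%N by rewrite rE ltn_Pmulr // ltnW.
apply: (@monochromatic_family_card ('I_q * 'I_d)%type).
  by rewrite card_prod !card_ord rE.
by apply: monochromatic_family_prod; rewrite ?card_ord ?(ltnW q_gt1) ?(ltnW d_gt1) //; exact: IH.
Qed.

(** * Products of Kneser hypergraphs *)

(** Deleting the vertices outside all classes leaves a hypergraph which the classes color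
    equitably. *)
Lemma ecd_balanced_free (r : nat) (G : hypergraph) (Y : {ffun 'I_r -> {set vert G}}) :
  (0 < r)%N -> balanced_free (edges G) setT Y ->
  (ecd r G + \sum_j #|Y j| <= #|vert G|)%N.
Proof.
move=> r_gt0 /balanced_freeP[_ dY fY bY].
have -> : (\sum_j #|Y j| = #|\bigcup_j Y j|)%N.
  rewrite -[RHS]sum1_card partition_disjoint_bigcup //.
  by apply: eq_bigr => j _; rewrite sum1_card.
rewrite -(cardC (mem (\bigcup_j Y j))) addnC leq_add2l.
set U := ~: \bigcup_j Y j.
have -> : #|[predC mem (\bigcup_j Y j)]| = #|U| by apply: eq_card => v; rewrite !inE.
apply: ecd_min; apply/existsP.
have UE v : (v \in ~: U) = (v \in \bigcup_j Y j) by rewrite setCK.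
pose S := vert (induced (~: U)).
have exj (w : S) : exists j, val w \in Y j.
  have : val w \in \bigcup_j Y j by rewrite -UE; exact: valP.
  by move=> /bigcupP[j _ wj]; exists j.
pose col : {ffun S -> 'I_r} := [ffun w => xchoose (exj w)].
have colP (w : S) : val w \in Y (col w) by rewrite ffunE; exact: (xchooseP (exj w)).
have colE (w : S) j : (col w == j) = (val w \in Y j).
  apply/eqP/idP => [<-//|wj]; apply/eqP/negPn/negP => /dY.
  by rewrite -setI_eq0 => /eqP/setP/(_ (val w)); rewrite !inE colP wj.
exists col; apply/andP; split.
  apply/forall_inP => e; rewrite inE => eG; apply/existsP => -[a /forall_inP ea].
  have /negP := fY a _ eG; apply; apply/subsetP => v /imsetP[w we ->].
  by rewrite -colE; exact: ea.
have cE a : #|[set w | col w == a]| = #|Y a|.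
  rewrite -(card_imset _ val_inj); apply: eq_card => v; apply/imsetP/idP.
    by move=> [w]; rewrite inE colE => wa ->.
  move=> va; have vU : v \in ~: U by rewrite UE; apply/bigcupP; exists a.
  by exists (Sub v vU); rewrite ?inE ?colE SubK.
by apply/forallP => a; apply/forallP => b; rewrite !cE addn1.
Qed.

Section TaggedProduct.
Variables (r t : nat) (hr : (1 < r)%N) (ht : (0 < t)%N) (H : 'I_t -> hypergraph).
Local Notation T := {i : 'I_t & vert (H i)}.
Local Notation G := (catprod ht (fun i => KG hr (H i))).

(** [monochromatic_family] has one vertex type for all coordinates, so the vertex sets are embedded
    into their disjoint sum. *)
Definition tag_set i (A : {set vert (H i)}) : {set T} :=
  [set Tagged (fun i => vert (H i)) v | v in A].

Lemma Tagged_inj i : injective (@Tagged _ i (fun i => vert (H i))).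
Proof. by move=> v w /eqP; rewrite eq_Tagged => /eqP. Qed.

Lemma tag_set_sub i (A B : {set vert (H i)}) :
  (tag_set A \subset tag_set B) = (A \subset B).
Proof.
apply/idP/idP => [/subsetP AB|]; last exact: imsetS.
apply/subsetP => v vA; have /AB := imset_f (@Tagged _ i (fun i => vert (H i))) vA.
by case/imsetP => w wB /Tagged_inj ->.
Qed.

Lemma tag_set_disjoint i (A B : {set vert (H i)}) :
  [disjoint tag_set A & tag_set B] = [disjoint A & B].
Proof.
rewrite -!setI_eq0 -imsetI; last by move=> ? ? _ _; exact: Tagged_inj.
by rewrite imset_eq0.
Qed.

Definition tag_verts i : {set T} := tag_set [set: vert (H i)].
Definition tag_edges i : {set {set T}} := [set tag_set e | e : {set vert (H i)} in edges (H i)].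

Lemma tag_edges_neq0 i : set0 \notin tag_edges i.
Proof.
apply/imsetP => -[e eH /esym/eqP]; rewrite imset_eq0 => /eqP e0.
by have := edges_neq0 (H i); rewrite -e0 eH.
Qed.

Lemma tag_defect i d : (d < ecd r (H i))%N ->
  defect_gt 'I_r (tag_edges i) (tag_verts i) d.
Proof.
move=> d_lt; apply/forallP => Y; apply/implyP => /balanced_freeP[sY dY fY bY].
pose Z : {ffun 'I_r -> {set vert (H i)}} := [ffun j => @Tagged _ i (fun i => vert (H i)) @^-1: Y j].
have YZ j : Y j = tag_set (Z j).
  apply/setP => x; apply/idP/imsetP => [xY|[v]]; last by rewrite ffunE inE => ? ->.
  have /imsetP[v _ xv] := subsetP (sY j) _ xY.
  by exists v; rewrite // ffunE inE -xv.
have cZ j : #|Y j| = #|Z j| by rewrite YZ card_imset //; exact: Tagged_inj.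
have bZ : balanced_free (edges (H i)) setT Z.
  apply/balanced_freeP; split=> [j|j k|j e eH|j k]; rewrite ?subsetT //.
  - by move/dY; rewrite !YZ tag_set_disjoint.
  - by rewrite -tag_set_sub -YZ; apply: fY; exact: imset_f.
  - by rewrite -!cZ.
rewrite (eq_bigr _ (fun j _ => cZ j)) card_imset ?cardsT; last exact: Tagged_inj.
apply: leq_trans (ecd_balanced_free (ltnW hr) bZ).
by rewrite addnC ltn_add2r.
Qed.

Lemma catprod_not_colorable C :
  (forall i, ((r - 1) * C < ecd r (H i))%N) -> ~~ colorable G C.
Proof.
move=> ecdC; apply/existsP => -[c0 c0P].
pose rep (F : {ffun 'I_t -> {set T}}) (x : vert G) := [forall i, tag_set (val (x i)) == F i].
(* The default 0 is taken only at tuples that represent no vertex of the product, hence never at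
   tuples of tagged edges. *)
pose c F := if [pick x | rep F x] is Some x then nat_of_ord (c0 x) else 0%N.
have repP (F : {ffun 'I_t -> {set T}}) : (forall i, F i \in tag_edges i) ->
    exists2 x, rep F x & c F = c0 x.
  move=> FE; rewrite /c; case: pickP => [x Fx|noF]; first by exists x.
  have ex i : exists y : vert (KG hr (H i)), tag_set (val y) == F i.
    have /imsetP[e eH ->] := FE i; by exists (exist _ e eH).
  pose x : vert G := [ffun i => xchoose (ex i)].
  by have /forallP[] := noF x => i; rewrite ffunE; exact: (xchooseP (ex i)).
have [F FE _|i|F [F1 F2 F3 F4]] :=
    monochromatic_family_ord hr (V := tag_verts) (E := tag_edges) (c := c) (C := C) tag_edges_neq0.
- by have [x _ ->] := repP F FE.
- by apply: tag_defect; rewrite card_ord.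
have ex j : exists x, rep (F j) x && (c (F j) == c0 x :> nat).
  by have [x Fx cx] := repP (F j) (F1 j); exists x; rewrite Fx cx eqxx.
pose x j := xchoose (ex j).
have xF j i : tag_set (val (x j i)) = F j i.
  by have /andP[/forallP/(_ i)/eqP] := xchooseP (ex j).
have xc j : c (F j) = c0 (x j) by have /andP[_ /eqP] := xchooseP (ex j).
have xD j k i : j != k -> [disjoint val (x j i) & val (x k i)].
  by move=> jk; rewrite -tag_set_disjoint !xF; exact: F3.
(* The projections must have exactly [r] elements; a repeated edge would be disjoint from itself,
   hence empty. *)
have x_inj i : injective (fun j => x j i).
  move=> j k /= ejk; apply/eqP/negPn/negP => /(xD _ _ i).
  rewrite ejk -setI_eq0 setIid => /eqP e0.
  by have := valP (x k i); rewrite e0 (negPf (edges_neq0 _)).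
pose e : {set vert G} := [set x j | j : 'I_r].
have eG : e \in edges G.
  rewrite inE; apply/forallP => i.
  have -> : [set y i | y : {dffun forall i, vert (KG hr (H i))} in e] = [set x j i | j : 'I_r].
    apply/setP => z; apply/imsetP/imsetP => [[y /imsetP[j _ ->] ->]|[j _ ->]].
      by exists j.
    by exists (x j) => //; exact: imset_f.
  rewrite inE card_imset; last exact: x_inj.
  rewrite card_ord eqxx /=.
  apply/trivIsetP => A B /imsetP[_ /imsetP[j _ ->] ->] /imsetP[_ /imsetP[k _ ->] ->] AB.
  by apply: xD; apply: contraNneq AB => ->.
have /forall_inP/(_ e eG)/negP := c0P; apply; apply/existsP.
pose j0 : 'I_r := Ordinal (ltnW hr).
exists (c0 (x j0)); apply/forall_inP => _ /imsetP[j _ ->]; apply/eqP/val_inj => /=.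
by rewrite -!xc; exact: F4.
Qed.

End TaggedProduct.

Theorem theorem2 (r t : nat) (hr : (1 < r)%N) (ht : (0 < t)%N)
    (H : 'I_t -> hypergraph) :
  (chi (catprod ht (fun i => KG hr (H i))))%:Z >=
  Num.ceil ((min_fam ht (fun i => ecd r (H i)))%:R / (r - 1)%N%:R : rat).
Proof.
set C := chi _; rewrite ceil_le_int ler_pdivrMr ?ltr0n ?subn_gt0 //.
(* If the minimum exceeded [C * (r - 1)], the product would not be [C]-colorable, although [chi] is
   attained. *)
rewrite -pmulrn -natrM ler_nat leqNgt; apply/negP => lt_ecd.
have ecdC i : ((r - 1) * C < ecd r (H i))%N.
  rewrite mulnC; apply: leq_trans lt_ecd _.
  exact: (min_fam_le ht (fun i => ecd r (H i))).
have /negP := @catprod_not_colorable r t hr ht H C ecdC; apply.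
by apply: chi_colorable => e; exact: catprod_KG_edges_gt1.
Qed.
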